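(* Suppose $0<s<1$. Then $X_s(\mathbb{R}^n)=H^1(\mathbb{R}^n)$, with equivalent norms.
   Context: For $1<q\le 2$ with conjugate exponent $2\le p<\infty$, $1/p+1/q=1$, and $0<s\le\infty$ (with $1/\infty=0$), a compactly supported function $a$ on $\mathbb{R}^n$ is a $(q,s)$ atom with defining cube $Q$ if $\mathrm{supp}(a)\subseteq Q$, $\int_Q a(x)\,dx=0$, and $$p^{1/s}\,|Q|\left(\frac1{|Q|}\int_Q|a(x)|^q\,dx\right)^{1/q}\le 1 .$$ $\mathcal{A}_s$ denotes the collection of all $(q,s)$ atoms, over all $1<q\le 2$ and all cubes $Q$; it is contained in the unit ball of $L^1(\mathbb{R}^n)$. The space $X_s=X_s(\mathbb{R}^n)$ consists of all $f\in L^1(\mathbb{R}^n)$ of the form $f=\sum_j\lambda_j a_j$ (convergence in $L^1$) with $a_j\in\mathcal{A}_s$ and $\sum_j|\lambda_j|<\infty$, normed by $\|f\|_{X_s}=\inf\sum_j|\lambda_j|$, the infimum being over all such decompositions of $f$. $H^1(\mathbb{R}^n)$ is the (real) Hardy space with its atomic norm. *)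

(* Defs.v *)
From HB Require Import structures.
From mathcomp Require Import all_boot all_order all_algebra.
From mathcomp Require Import all_classical all_reals all_analysis.

Set Implicit Arguments.
Unset Strict Implicit.
Unset Printing Implicit Defensive.

Import Order.TTheory GRing.Theory Num.Theory.
Import numFieldNormedType.Exports.

Local Open Scope classical_set_scope.
Local Open Scope ring_scope.

(* R^n, with the product sigma-algebra of the Borel sets of R. *)
Notation Rn R n := (n.-tuple (measurableTypeR R)).

Section lebesgue_measure_Rn.
Context {R : realType}.
Local Open Scope ereal_scope.

Definition Rn_cons n (z : measurableTypeR R * Rn R n) : Rn R n.+1 :=
  [tuple of z.1 :: z.2].

Definition Rn_uncons n (x : Rn R n.+1) : measurableTypeR R * Rn R n :=
  (thead x, [tuple of behead x]).

Lemma Rn_unconsK n : cancel (@Rn_uncons n) (@Rn_cons n).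
Proof. by move=> x; rewrite /Rn_cons /=; exact/esym/tuple_eta. Qed.

Lemma Rn_consK n : cancel (@Rn_cons n) (@Rn_uncons n).
Proof.
by move=> [x y]; rewrite /Rn_uncons /Rn_cons /= theadE; congr pair; apply/val_inj.
Qed.

Lemma measurable_Rn_cons n : measurable_fun [set: _] (@Rn_cons n).
Proof.
exact: (@measurable_cons _ _ (measurableTypeR R * Rn R n)%type
  (measurableTypeR R) fst n snd measurable_fst measurable_snd).
Qed.

Lemma measurable_Rn_uncons n : measurable_fun [set: _] (@Rn_uncons n).
Proof.
by apply: measurable_fun_pair; [exact: measurable_tnth|exact: measurable_behead].
Qed.

(* The library's canonical sigma-finite structure on products is shadowed by the
   one for finite measures. *)
Lemma sigma_finite_product d1 d2 (T1 : measurableType d1)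
    (T2 : measurableType d2) (m1 : {sigma_finite_measure set T1 -> \bar R})
    (m2 : {sigma_finite_measure set T2 -> \bar R}) :
  sigma_finite setT (m1 \x m2).
Proof.
have /sigma_finiteP[F [FT ndF Foo]] := sigma_finiteT m1.
have /sigma_finiteP[G [GT ndG Goo]] := sigma_finiteT m2.
exists (fun i => F i `*` G i).
  rewrite -setXTT FT GT predeqE => -[x y]; split.
    move=> [/= [i _ Fix] [k _ Gky]]; exists (maxn i k) => //; split.
    - by move: x Fix; exact/subsetPset/ndF/leq_maxl.
    - by move: y Gky; exact/subsetPset/ndG/leq_maxr.
  by move=> [i _ []/= ? ?]; split; exists i.
move=> k; have [? ?] := Foo k; have [? ?] := Goo k.
split; first exact: measurableX.
by rewrite product_measure1E// lte_mul_pinfty// ge0_fin_numE.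
Qed.

Section step.
Variables (n : nat) (mu : {sigma_finite_measure set (Rn R n) -> \bar R}).

Definition lebesgue_Rn_step : set (Rn R n.+1) -> \bar R :=
  pushforward (@lebesgue_measure R \x mu) (@Rn_cons n).

Let preimage_Rn_cons_measurable (A : set (Rn R n.+1)) :
  measurable A -> measurable (@Rn_cons n @^-1` A).
Proof.
by move=> mA; rewrite -[X in measurable X]setTI; exact: measurable_Rn_cons.
Qed.

Let lebesgue_Rn_step0 : lebesgue_Rn_step set0 = 0.
Proof. by rewrite /lebesgue_Rn_step /pushforward preimage_set0 measure0. Qed.

Let lebesgue_Rn_step_ge0 A : 0 <= lebesgue_Rn_step A.
Proof. by rewrite /lebesgue_Rn_step /pushforward; exact: measure_ge0. Qed.

Let lebesgue_Rn_step_sigma_additive : semi_sigma_additive lebesgue_Rn_step.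
Proof.
move=> F mF tF mUF; rewrite /lebesgue_Rn_step /pushforward preimage_bigcup.
apply: measure_semi_sigma_additive.
- by move=> k; exact: preimage_Rn_cons_measurable.
- apply/trivIsetP => /= a b _ _ ab; rewrite -preimage_setI.
  by move/trivIsetP : tF => /(_ _ _ _ _ ab) ->//; rewrite preimage_set0.
- by rewrite -preimage_bigcup; exact: preimage_Rn_cons_measurable.
Qed.

HB.instance Definition _ := isMeasure.Build _ _ _ lebesgue_Rn_step
  lebesgue_Rn_step0 lebesgue_Rn_step_ge0 lebesgue_Rn_step_sigma_additive.

Let lebesgue_Rn_step_sigma_finite : sigma_finite setT lebesgue_Rn_step.
Proof.
have [F FT mF] : sigma_finite setT (@lebesgue_measure R \x mu).
  exact: sigma_finite_product.
exists (fun i => @Rn_uncons n @^-1` F i).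
  by rewrite -preimage_bigcup -FT preimage_setT.
move=> i; have [mFi Fioo] := mF i; split.
  by rewrite -[X in measurable X]setTI; exact: measurable_Rn_uncons.
rewrite /lebesgue_Rn_step /pushforward -comp_preimage.
by rewrite (_ : _ \o _ = id) //; apply/funext => z /=; exact: Rn_consK.
Qed.

HB.instance Definition _ := Measure_isSigmaFinite.Build _ _ _
  lebesgue_Rn_step lebesgue_Rn_step_sigma_finite.

End step.

(* R^0 is a point, of mass 1; R^{n+1} is identified with R x R^n. *)
Fixpoint lebesgue_Rn n : {sigma_finite_measure set (Rn R n) -> \bar R} :=
  match n with
  | 0 => \d_([tuple] : Rn R 0)
  | m.+1 => lebesgue_Rn_step (lebesgue_Rn m)
  end.

End lebesgue_measure_Rn.
Arguments lebesgue_Rn : clear implicits.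

Section atomic_spaces.
Context {R : realType} {n : nat}.
Implicit Types (A : set (Rn R n -> R)) (Q : set (Rn R n)) (a f : Rn R n -> R).

Local Notation mu := (lebesgue_Rn R n).

Definition cube (c : Rn R n) (l : R) : set (Rn R n) :=
  [set x | forall i, tnth c i <= tnth x i <= tnth c i + l].

Definition is_cube Q := exists c l, 0 < l /\ Q = cube c l.

Definition vol Q : R := fine (mu Q).

(* Cubes are closed, so [a] vanishes off [Q] exactly when the closed support
   of [a] is contained in [Q]; in particular [a] is compactly supported. *)
Definition supported_in Q a := forall x, ~ Q x -> a x = 0.

Definition mean_zero Q a := (\int[mu]_(x in Q) (a x)%:E = 0)%E.

(* The inverse of [s] is taken in the extended reals, where +oo^-1 = 0. *)
Definition qs_atom (q : R) (s : \bar R) Q a := exists p : R,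
  [/\ p^-1 + q^-1 = 1,
      measurable_fun [set: Rn R n] a,
      supported_in Q a,
      mean_zero Q a &
      ((p `^ fine s^-1 * vol Q)%:E *
       ((vol Q)^-1%:E * \int[mu]_(x in Q) (`|a x| `^ q)%:E) `^ q^-1 <= 1)%E].

Definition atoms_s (s : \bar R) : set (Rn R n -> R) :=
  [set a | exists q Q, [/\ 1 < q, q <= 2, is_cube Q & qs_atom q s Q a]].

(* The classical (1, oo)-atoms of the Hardy space. *)
Definition H1_atoms : set (Rn R n -> R) :=
  [set a | exists Q,
    [/\ is_cube Q, measurable_fun [set: Rn R n] a, supported_in Q a,
        mean_zero Q a & ((vol Q)%:E * 'N[mu]_+oo[EFin \o a] <= 1)%E]].

(* The series converges in L^1; finite decompositions are those where [lam] is
   eventually zero. *)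
Definition atomic_decomposition A f (lam : nat -> R) (a : nat -> Rn R n -> R) :=
  [/\ forall j, A (a j),
      (\sum_(0 <= j <oo) `|lam j|%:E < +oo)%E &
      ('N[mu]_1[(fun x => (f x - \sum_(j < N) lam j * a j x)%:E)])%E
        @[N --> \oo] --> 0%E].

(* Elements of L^1 are represented by integrable functions; the space and the
   norm below only depend on their classes modulo a.e. equality. *)
Definition atomic_space A : set (Rn R n -> R) :=
  [set f | mu.-integrable [set: Rn R n] (EFin \o f) /\
    exists lam (a : nat -> Rn R n -> R), atomic_decomposition A f lam a].

Definition atomic_norm A f : \bar R :=
  ereal_inf [set v | exists lam (a : nat -> Rn R n -> R),
    atomic_decomposition A f lam a /\ v = (\sum_(0 <= j <oo) `|lam j|%:E)%E].

End atomic_spaces.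

Definition X_space (R : realType) (n : nat) (s : \bar R) : set (Rn R n -> R) :=
  atomic_space (@atoms_s R n s).

Definition X_norm (R : realType) (n : nat) (s : \bar R) (f : Rn R n -> R) :
    \bar R :=
  atomic_norm (@atoms_s R n s) f.

Definition H1_space (R : realType) (n : nat) : set (Rn R n -> R) :=
  atomic_space (@H1_atoms R n).

Definition H1_norm (R : realType) (n : nat) (f : Rn R n -> R) : \bar R :=
  atomic_norm (@H1_atoms R n) f.

Arguments X_space R n s : clear implicits.
Arguments H1_space R n : clear implicits.

(* Main.v *)
Require Import Defs.
From mathcomp Require Import all_boot all_order all_algebra.
From mathcomp Require Import all_classical all_reals all_analysis.
From mathcomp Require Import measurable_realfun ess_sup_inf lra.

(** A (1,oo)-atom divided by 2^(1/s) is a (2,s)-atom, because on a cube the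
    normalised L^2 norm is at most the L^oo norm (H1_atom_atoms_s); hence H^1 is
    contained in X_s.  For the converse, series of decomposable functions are
    decomposable with the sum of the weights (decomposable_series), so it is
    enough to decompose one (q,s)-atom [a] into (1,oo)-atoms with a total weight
    bounded independently of q (decomposable_atoms_s).

    Let Q be the defining cube of [a], let p be the exponent conjugate to q and
    put alpha = 1 / (p^(1/s) |Q|), so that the integral of |a|^q is at most
    alpha^q |Q|.  For j >= 1 consider the maximal dyadic cubes on which the
    average of |a| exceeds 2^j alpha, and let g_j be [a] with its values replaced
    by its average on each of these cubes.  Then |g_j| <= 2^n 2^j alpha almost
    everywhere: on a selected cube because its parent is not selected
    (ae_stopped_le), and off the selected cubes because |a| <= 2^j alpha there
    (ae_le_threshold).  With the height 0 in place of 2^j alpha for j = 0, one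
    gets g_0 = 0, since [a] has integral 0.

    Selected cubes shrink as j grows, and averaging does not change the integral
    over a cube, so g_(j+1) - g_j restricted to a cube P selected at height j has
    integral 0, lives on P and is bounded by 2^(n+1) 2^(j+1) alpha: it is a
    (1,oo)-atom times a weight comparable to 2^j alpha |P|.  On a selected cube
    Jensen's inequality gives (2^j alpha)^q |P| <= int_P |a|^q (mass_power), so
    the weights at height j add up to at most a constant times
    alpha |Q| 2^(j(1-q)), and g_j converges to [a] in L^1.  The geometric series
    over j is at most a constant times p alpha |Q| = p^(1-1/s)
    (inv_sub_ratio_le), which is at most that constant as p >= 1 and s < 1.

    The bound |a| <= 2^j alpha off the selected cubes is usually read off from
    Lebesgue's differentiation theorem.  Here it comes from the monotone class
    theorem: a function whose integral over each dyadic cube is nonnegative has a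
    nonnegative integral over every measurable set (ae_ge0_of_cells). *)

Set Implicit Arguments.
Unset Strict Implicit.
Unset Printing Implicit Defensive.

Import Order.TTheory GRing.Theory Num.Theory.
Import numFieldNormedType.Exports.

Local Open Scope classical_set_scope.
Local Open Scope ring_scope.

(** * Series of nonnegative terms *)

Lemma small_tail (R : realType) (u : nat -> R) (W e : R) : (forall k, 0 <= u k) ->
  (forall N, \sum_(k < N) u k <= W) -> 0 < e ->
  exists M, forall N, (M <= N)%N -> \sum_(M <= k < N) u k <= e.
Proof.
move=> u0 uW e0.
have [|_ [M _ <-] HM] := @sup_adherent R (range (fun N => \sum_(k < N) u k)) e e0.
  split; first by exists (\sum_(k < 0) u k); exists 0%N.
  by exists W => _ [N _ <-].
exists M => N MN; rewrite -(lerD2l (\sum_(k < M) u k)).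
have -> : \sum_(k < M) u k + \sum_(M <= k < N) u k = \sum_(k < N) u k.
  by rewrite -!(big_mkord xpredT u) -big_cat_nat.
apply: le_trans (_ : sup (range (fun N => \sum_(k < N) u k)) <= _).
  apply: ub_le_sup; last by exists N.
  by exists W => _ [N' _ <-].
by move: HM; rewrite ltrBlDr => /ltW.
Qed.

Section ereal_limits.
Context {R : realType}.
Local Open Scope ereal_scope.

(** Turns convergence to 0 of L^1 norms, which are extended reals, into a
    statement about real bounds that combines with the triangle inequality. *)
Lemma cvge0P (u : nat -> \bar R) : (forall N, 0 <= u N) ->
  u @ \oo --> 0 <->
  (forall e : R, (0 < e)%R -> exists N0, forall N, (N0 <= N)%N -> u N <= e%:E).
Proof.
move=> u0; split=> [u_0 e e0|H].
  have [N _ HN] : \forall N \near \oo, u N <= e%:E.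
    apply: (u_0 [set x | x <= e%:E]); exists e => //= r /=.
    rewrite sub0r normrN => re; rewrite lee_fin.
    exact: le_trans (ler_norm _) (ltW re).
  by exists N => m; exact: HN.
move=> P [e /= e0 Pe]; have [N0 HN] := H (e / 2)%R (divr_gt0 e0 (ltr0n _ 2)).
exists N0 => //= N /HN uN.
have ufin : u N \is a fin_num by rewrite ge0_fin_numE// (le_lt_trans uN)// ltry.
rewrite /= -(fineK ufin); apply: Pe => /=.
rewrite sub0r normrN ger0_norm ?fine_ge0//.
move: uN; rewrite -{1}(fineK ufin) lee_fin => /le_lt_trans; apply.
by rewrite ltr_pdivrMr// ltr_pMr// ltr1n.
Qed.

Lemma nneseries_le (u : nat -> \bar R) (W : \bar R) : (forall k, 0 <= u k) ->
  (forall N, \sum_(k < N) u k <= W) -> \sum_(0 <= k <oo) u k <= W.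
Proof.
move=> u0 H; apply: lime_le; first exact: is_cvg_nneseries.
by apply: nearW => N; rewrite /= big_mkord.
Qed.

Lemma nneseries_ge_partial (u : nat -> \bar R) N : (forall k, 0 <= u k) ->
  \sum_(k < N) u k <= \sum_(0 <= k <oo) u k.
Proof.
by move=> u0; rewrite -(big_mkord xpredT u); exact: nneseries_lim_ge.
Qed.

End ereal_limits.

(** * Integrals and the L^1 norm *)

Section measure_preliminaries.
Context d (T : measurableType d) (R : realType) (mu : {measure set T -> \bar R}).

Lemma integral_supported (Q A : set T) (f : T -> \bar R) :
  Q `<=` A -> (forall x, ~ Q x -> f x = 0%E) ->
  (\int[mu]_(x in A) f x = \int[mu]_(x in Q) f x)%E.
Proof.
move=> QA f0; rewrite [LHS]integral_mkcond [RHS]integral_mkcond.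
apply: eq_integral => x _; rewrite /patch.
have [Qx|nQx] := pselect (Q x); first by rewrite !mem_set//; exact: QA.
by rewrite (memNset nQx) f0//; case: ifP.
Qed.

Lemma integrable_indic_lty (A : set T) : measurable A -> (mu A < +oo)%E ->
  mu.-integrable setT (fun x => (\1_A x : R)%:E).
Proof.
move=> mA Afin; apply/integrableP; split; first exact/measurable_EFinP.
rewrite (eq_integral (fun x => (\1_A x)%:E)) => [|x _].
  by rewrite integral_indic// setIT.
by rewrite gee0_abs// lee_fin.
Qed.

Lemma measurable_norm_powR (A : set T) (f : T -> R) (q : R) :
  measurable_fun A f -> measurable_fun A (fun x => `|f x| `^ q).
Proof.
move=> mf; apply: (@measurableT_comp _ _ _ _ _ _ (fun y : R => y `^ q) _
  (fun x => `|f x|)); first exact: measurable_powR.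
exact: measurableT_comp.
Qed.

Lemma measurable_sum_cond (I : eqType) (s : seq I) (P : pred I)
    (F : I -> T -> R) : (forall i, measurable_fun setT (F i)) ->
  measurable_fun setT (fun x => \sum_(i <- s | P i) F i x).
Proof.
move=> mF; under eq_fun do rewrite big_mkcond.
by apply: measurable_sum => i; case: (P i).
Qed.

(** Covers increasing unions and decreasing intersections alike, which is what
    the monotone class theorem asks for; integrability of [h] makes both cases an
    instance of dominated convergence. *)
Lemma integral_eventually_cvg (h : T -> \bar R) (F : nat -> set T) (E : set T) :
  mu.-integrable setT h -> (forall k, measurable (F k)) -> measurable E ->
  (forall x, \forall k \near \oo, F k x <-> E x) ->
  (fun k => \int[mu]_(x in F k) h x)%E @ \oo --> (\int[mu]_(x in E) h x)%E.
Proof.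
move=> ih mF mE FE.
rewrite (integral_mkcond E); under eq_fun do rewrite integral_mkcond.
have mh := measurable_int _ ih.
have [|||||//] := @dominated_convergence _ _ _ mu setT measurableT
  (fun k => h \_ (F k)) (h \_ E) (abse \o h).
- move=> k; apply/(measurable_restrictT h) => //.
  exact: measurable_funS mh.
- apply/(measurable_restrictT h) => //; exact: measurable_funS mh.
- apply: aeW => x _; apply: cvg_near_cst.
  apply: filterS (FE x) => k FkE; rewrite /patch.
  by congr (if _ then _ else _); apply/idP/idP; rewrite !inE => /FkE.
- exact: integrable_abse.
- apply: aeW => x k _; rewrite /patch /=; case: ifP => // _.
  by rewrite abse0.
Qed.

End measure_preliminaries.

Section L1_norm.
Context d (T : measurableType d) (R : realType) (mu : {measure set T -> \bar R}).
Local Open Scope ereal_scope.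
Implicit Types f g : T -> R.

Definition L1_norm f := \int[mu]_x `|f x|%:E.

Let measurable_norm f : measurable_fun setT f ->
  measurable_fun setT (EFin \o (fun x => `|f x| : R)%R).
Proof. by move=> mf; apply/measurable_EFinP; exact: measurableT_comp. Qed.

Lemma Lnorm1_EFin f : 'N[mu]_1[EFin \o f] = L1_norm f.
Proof. by rewrite Lnorm1. Qed.

Lemma L1_norm_ge0 f : 0 <= L1_norm f.
Proof. by apply: integral_ge0 => x _; rewrite lee_fin. Qed.

Lemma L1_norm0 : L1_norm (fun=> 0%R) = 0.
Proof.
rewrite /L1_norm; under eq_integral do rewrite normr0; exact: integral0.
Qed.

Lemma L1_normD f g : measurable_fun setT f -> measurable_fun setT g ->
  L1_norm (fun x => f x + g x)%R <= L1_norm f + L1_norm g.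
Proof.
move=> mf mg; rewrite /L1_norm -ge0_integralD//; last 2 first.
- exact: measurable_norm.
- exact: measurable_norm.
apply: ge0_le_integral => //.
- by apply: measurable_norm; exact: measurable_funD.
- by apply: emeasurable_funD; exact: measurable_norm.
- by move=> x _; rewrite -EFinD lee_fin ler_normD.
Qed.

Lemma L1_normZ f c : measurable_fun setT f ->
  L1_norm (fun x => c * f x)%R = `|c|%:E * L1_norm f.
Proof.
move=> mf; rewrite /L1_norm -ge0_integralZl//; last exact: measurable_norm.
by apply: eq_integral => x _; rewrite normrM EFinM.
Qed.

Lemma L1_norm_sum (I : eqType) (s : seq I) (P : pred I) (F : I -> T -> R) :
  (forall i, measurable_fun setT (F i)) ->
  L1_norm (fun x => \sum_(i <- s | P i) F i x)%R <=
  \sum_(i <- s | P i) L1_norm (F i).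
Proof.
move=> mF; elim: s => [|i s IH].
  rewrite !big_nil; under [X in L1_norm X]eq_fun do rewrite big_nil.
  by rewrite L1_norm0.
under [X in L1_norm X]eq_fun do rewrite big_cons.
rewrite big_cons; case: ifPn => // _.
apply: le_trans (L1_normD (mF i) _) _.
  exact: measurable_sum_cond.
by rewrite leeD2l.
Qed.

Lemma ae_eq_L1_norm f g : measurable_fun setT f -> measurable_fun setT g ->
  {ae mu, forall x, f x = g x} -> L1_norm f = L1_norm g.
Proof.
move=> mf mg fg; apply: ge0_ae_eq_integral => //.
- exact: measurable_norm.
- exact: measurable_norm.
- by move: fg; apply: filterS => x fgx _ ; rewrite fgx.
Qed.

End L1_norm.

Section partition.
Context d (T : measurableType d) (R : realType) (mu : {measure set T -> \bar R}).
Variables (P : nat -> set T) (h : T -> R).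
Hypothesis mP : forall m, measurable (P m).
Hypothesis tP : trivIset setT P.
Hypothesis ih : mu.-integrable setT (EFin \o h).
Hypothesis h_out : forall x, ~ (\bigcup_m P m) x -> h x = 0.

(** At most one term is nonzero, so the partial sums are 0 up to the index of the
    piece containing [x] and [h x] afterwards. *)
Lemma sum_partition x : exists m0, forall N,
  \sum_(m < N) h x * \1_(P m) x = h x * (m0 < N)%N%:R.
Proof.
have [[m0 _ Px]|nx] := pselect ((\bigcup_m P m) x); last first.
  by exists 0%N => N; rewrite h_out// mul0r big1// => m _; rewrite mul0r.
have out m : m != m0 -> \1_(P m) x = 0 :> R.
  move=> mm0; rewrite indicE memNset// => Pmx.
  by move/trivIsetP : tP => /(_ m m0 I I mm0); apply/eqP/set0P; exists x.
exists m0 => N.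
have [m0N|Nm0] := ltnP m0 N.
  rewrite (bigD1 (Ordinal m0N))//= indicE mem_set// big1 ?addr0// => m mm0.
  by rewrite out ?mulr0//; apply: contraNneq mm0 => mE; apply/eqP/val_inj.
rewrite big1 ?mulr0// => m _; rewrite out ?mulr0//.
by rewrite ltn_eqF// (leq_trans (ltn_ord m)).
Qed.

Lemma cvg_partition : (fun N => L1_norm mu
  (fun x => h x - \sum_(m < N) h x * \1_(P m) x)) @ \oo --> 0%E.
Proof.
have mh : measurable_fun setT h.
  by apply/measurable_EFinP; exact: measurable_int ih.
have mS N : measurable_fun setT (fun x => \sum_(m < N) h x * \1_(P m) x).
  by apply: measurable_sum => m; apply: measurable_funM.
have [|||||_ H _] := @dominated_convergence _ _ _ mu setT measurableT
  (fun N x => (\sum_(m < N) h x * \1_(P m) x)%:E) (EFin \o h)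
  (fun x => `|h x|%:E).
- by move=> N; exact/measurable_EFinP.
- exact/measurable_EFinP.
- apply: aeW => x _; apply: cvg_near_cst.
  have [m0 sumE] := sum_partition x.
  by exists m0.+1 => // N /= m0N; rewrite sumE m0N mulr1.
- exact: integrable_norm ih.
- apply: aeW => x N _; rewrite /= lee_fin.
  have [m0 ->] := sum_partition x.
  by rewrite normrM ler_piMr// normr_nat; case: (_ < _)%N.
rewrite (_ : (fun _ => _) = (fun N => \int[mu]_x
  `|(\sum_(m < N) h x * \1_(P m) x)%:E - (EFin \o h) x|)%E)//.
apply/funext => N; apply: eq_integral => x _ /=.
by rewrite distrC.
Qed.

End partition.

(** * Series of decomposable functions *)

Section reindexing.

(** The pairs (j, k) are coded by the natural numbers [pickle (j, k)].  The
    partial inverse is [pickle_inv] rather than [unpickle] because the former is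
    defined on codes only, so that no pair is met twice. *)
Definition in_box (J K m : nat) : bool :=
  if @pickle_inv (nat * nat)%type m is Some p then (p.1 < J)%N && (p.2 < K)%N
  else false.

Definition unpair (V : nmodType) (F : nat -> nat -> V) (m : nat) : V :=
  if @pickle_inv (nat * nat)%type m is Some p then F p.1 p.2 else 0.

(** Together with [pickle_box], this compares the initial segments of the
    enumeration with the boxes j < J, k < K, in both directions. *)
Lemma in_box_total M : exists J, forall m, (m < M)%N ->
  forall p : nat * nat, pickle_inv m = Some p -> (p.1 < J)%N && (p.2 < J)%N.
Proof.
elim: M => [|M [J HJ]]; first by exists 0%N.
case E : (@pickle_inv (nat * nat)%type M) => [[j k]|]; last first.
  exists J => m; rewrite ltnS leq_eqVlt => /predU1P[->|/HJ//].
  by move=> p; rewrite E.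
exists (maxn J (maxn j k).+1) => m.
rewrite ltnS leq_eqVlt => /predU1P[-> p|/HJ{}HJ p /HJ/andP[pJ1 pJ2]].
  by rewrite E => -[<-] /=; rewrite !leq_max !ltnS !leq_max !leqnn !orbT.
by rewrite !leq_max pJ1 pJ2.
Qed.

Lemma pickle_box J K : exists M, forall j k, (j < J)%N -> (k < K)%N ->
  (pickle (j, k) < M)%N.
Proof.
exists (\max_(p : 'I_J * 'I_K) pickle (p.1 : nat, p.2 : nat)).+1 => j k jJ kK.
by rewrite ltnS (leq_bigmax (Ordinal jJ, Ordinal kK)).
Qed.

Lemma sum_in_box (V : nmodType) (F : nat -> nat -> V) J K M :
  (forall j k, (j < J)%N -> (k < K)%N -> (pickle (j, k) < M)%N) ->
  \sum_(m < M | in_box J K m) unpair F m = \sum_(j < J) \sum_(k < K) F j k.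
Proof.
move=> HM; rewrite -(big_mkord (in_box J K) (unpair F)) -big_filter.
rewrite (perm_big
  [seq pickle (j, k) | j <- index_iota 0 J, k <- index_iota 0 K]); last first.
  apply: uniq_perm.
  - by rewrite filter_uniq// iota_uniq.
  - apply: allpairs_uniq; rewrite ?iota_uniq// => -[j k] [j' k'] _ _ /=.
    by move/(pcan_inj pickleK).
  move=> m; rewrite mem_filter mem_index_iota /=; apply/idP/idP.
    rewrite /in_box => /andP[+ _].
    case E : (pickle_inv m) => [[j k]|//] /= /andP[jJ kK].
    apply/allpairsP; exists (j, k); rewrite !mem_index_iota /=; split=> //.
    by have := @pickle_invK (nat * nat)%type m; rewrite /= E.
  move=> /allpairsP[[j k] /=]; rewrite !mem_index_iota /= => -[jJ kK ->].
  by rewrite HM// andbT /in_box pickleK_inv /= jJ.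
rewrite big_allpairs_dep big_mkord; apply: eq_bigr => j _; rewrite big_mkord.
by apply: eq_bigr => k _; rewrite /unpair pickleK_inv.
Qed.

End reindexing.

Section L1_remainders.
Context {R : realType} {n : nat}.
Local Notation mu := (lebesgue_Rn R n).
Local Notation T := (Rn R n).

Lemma Lnorm1_remainder (f : T -> R) (lam : nat -> R) (a : nat -> T -> R) :
  (fun N => 'N[mu]_1[(fun x => (f x - \sum_(j < N) lam j * a j x)%:E)]%E) =
  (fun N => L1_norm mu (fun x => f x - \sum_(j < N) lam j * a j x)).
Proof. by apply/funext => N; exact: Lnorm1_EFin. Qed.

Lemma atomic_decompositionP (A : set (T -> R)) (f : T -> R) (lam : nat -> R)
    (a : nat -> T -> R) :
  atomic_decomposition A f lam a <->
  [/\ forall j, A (a j), (\sum_(0 <= j <oo) `|lam j|%:E < +oo)%E &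
   (fun N => L1_norm mu (fun x => f x - \sum_(j < N) lam j * a j x)) @ \oo
     --> 0%E].
Proof. by rewrite -Lnorm1_remainder. Qed.

End L1_remainders.

Section decomposable.
Context {R : realType} {n : nat}.
Local Notation mu := (lebesgue_Rn R n).
Local Notation T := (Rn R n).
Variable A : set (T -> R).
Hypothesis A0 : A (fun=> 0).
Hypothesis measurable_A : forall a, A a -> measurable_fun setT a.
Hypothesis L1_norm_A : forall a, A a -> (L1_norm mu a <= 1)%E.

(** [w] bounds the total weight of one decomposition of [f], whereas
    [atomic_norm] is an infimum over all of them: the former statement is the one
    that can be summed. *)
Definition decomposable (f : T -> R) (w : R) := exists lam a,
  atomic_decomposition A f lam a /\
  (\sum_(0 <= j <oo) `|lam j|%:E <= w%:E)%E.

(** Absolutely convergent double series may be summed in any order.  For M large,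
    the M-th partial sum of the single series differs from [f] by three errors:
    the tail of the outer series at J, the tails at K of the inner series with
    j < J, and the terms outside the box j < J, k < K.  The atoms have L^1 norm
    at most 1, so the last error is at most a tail of the convergent series of
    weights. *)
Lemma decomposable_series (f : T -> R) (s : nat -> T -> R) (w : nat -> R)
    (W : R) :
  measurable_fun setT f -> (forall j, measurable_fun setT (s j)) ->
  (forall j, decomposable (s j) (w j)) ->
  (forall N, \sum_(j < N) w j <= W) ->
  (fun N => L1_norm mu (fun x => f x - \sum_(j < N) s j x)) @ \oo --> 0%E ->
  decomposable f W.
Proof.
move=> mf ms sw wW fs.
have /choice[la Hla] : forall j, exists la : (nat -> R) * (nat -> T -> R),
    atomic_decomposition A (s j) la.1 la.2 /\
    (\sum_(0 <= k <oo) `|la.1 k|%:E <= (w j)%:E)%E.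
  by move=> j; have [lam [a H]] := sw j; exists (lam, a).
pose lam j k := (la j).1 k; pose a j k := (la j).2 k.
pose nu m := unpair lam m.
pose b m : T -> R := if @pickle_inv (nat * nat)%type m is Some p
  then a p.1 p.2 else fun=> 0.
have Aa j k : A (a j k) by have [[+ _ _] _] := Hla j; apply.
have Ab m : A (b m) by rewrite /b; case: pickle_inv.
have mb m : measurable_fun setT (b m) by exact: measurable_A.
have lamw j K : \sum_(k < K) `|lam j k| <= w j.
  have [_] := Hla j; rewrite -lee_fin; apply: le_trans.
  rewrite -sumEFin; apply: (@nneseries_ge_partial _ (fun k => `|lam j k|%:E)).
  by move=> k; rewrite lee_fin.
have nuE m : `|nu m| = unpair (fun j k => `|lam j k|) m.
  by rewrite /nu /unpair; case: pickle_inv => //; rewrite normr0.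
have nuW M : \sum_(m < M) `|nu m| <= W.
  have [J HJ] := in_box_total M; have [M' HM'] := pickle_box J J.
  apply: le_trans (wW J).
  apply: le_trans (_ : \sum_(j < J) \sum_(k < J) `|lam j k| <= _); last first.
    by apply: ler_sum => j _; exact: lamw.
  have HM'' j k : (j < J)%N -> (k < J)%N -> (pickle (j, k) < maxn M M')%N.
    by move=> jJ kJ; rewrite leq_max HM' ?orbT.
  rewrite -(sum_in_box (fun j k => `|lam j k|) HM'').
  under [leRHS]eq_bigr do rewrite -nuE.
  rewrite -(big_mkord (in_box J J) (fun m => `|nu m|)).
  rewrite (big_cat_nat (leq0n M) (leq_maxl M M'))/= big_mkord.
  apply: ler_wpDr; first by apply: sumr_ge0.
  rewrite [leRHS]big_mkcond /=; apply: ler_sum => m _.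
  rewrite /in_box nuE /unpair.
  by case E : pickle_inv => [p|]//; rewrite (HJ _ (ltn_ord m) p E).
exists nu, b; split; last first.
  apply: nneseries_le => [k|N]; first by rewrite lee_fin.
  by rewrite sumEFin lee_fin.
split => //.
  apply: le_lt_trans (ltry W); apply: nneseries_le => [k|N]; first by rewrite lee_fin.
  by rewrite sumEFin lee_fin.
rewrite Lnorm1_remainder.
apply/cvge0P => [N|e e0]; first exact: L1_norm_ge0.
have e3 : 0 < e / 3 by rewrite divr_gt0.
(* The weights beyond M1 are negligible, and the box contains all pairs coded
   below M1, so the terms outside the box are among the negligible ones. *)
have [M1 HM1] := small_tail (fun m => normr_ge0 (nu m)) nuW e3.
have [J1 HJ1] := in_box_total M1.
have [J0 HJ0] := (cvge0P (fun N => L1_norm_ge0 mu _)).1 fs _ e3.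
pose J := maxn J0 J1.
have eJ : 0 < e / 3 / J.+1%:R by rewrite divr_gt0.
have /choice[Kj HKj] : forall j, exists K0, forall K, (K0 <= K)%N ->
    (L1_norm mu (fun x => s j x - \sum_(k < K) lam j k * a j k x)%R
      <= (e / 3 / J.+1%:R)%:E)%E.
  move=> j; have [[_ _ sj] _] := Hla j.
  apply: (cvge0P (fun N => L1_norm_ge0 mu _)).1 _ eJ.
  by rewrite -Lnorm1_remainder.
pose K := maxn J1 (\max_(j < J) Kj j).
have [M2 HM2] := pickle_box J K.
exists (maxn M1 M2) => M; rewrite geq_max => /andP[M1M M2M].
have HM j k : (j < J)%N -> (k < K)%N -> (pickle (j, k) < M)%N.
  by move=> jJ kK; apply: leq_trans M2M; exact: HM2.
have -> : (fun x => f x - \sum_(m < M) nu m * b m x) =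
  (fun x => (f x - \sum_(j < J) s j x) +
    (\sum_(j < J) (s j x - \sum_(k < K) lam j k * a j k x) +
     \sum_(m < M | ~~ in_box J K m) - nu m * b m x)).
  apply/funext => x; rewrite (bigID (fun m : 'I_M => in_box J K m))/=.
  have -> : \sum_(i < M | in_box J K i) nu i * b i x =
      \sum_(j < J) \sum_(k < K) lam j k * a j k x.
    rewrite -(sum_in_box (fun j k => lam j k * a j k x) HM).
    apply: eq_bigr => m _; rewrite /nu /b /unpair.
    by case: pickle_inv => //; rewrite mul0r.
  under [X in _ = _ + (_ + X)]eq_bigr do rewrite mulNr.
  by rewrite sumrN sumrB; lra.
have mterm j : measurable_fun setT
    (fun x => s j x - \sum_(k < K) lam j k * a j k x).
  apply: measurable_funB => //; apply: measurable_sum_cond => k; apply: measurable_funM => //.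
  exact: measurable_A.
have mtail m : measurable_fun setT (fun x => - nu m * b m x).
  exact: measurable_funM.
apply: le_trans (L1_normD mu _ _) _.
- by apply: measurable_funB => //; exact: measurable_sum_cond.
- by apply: measurable_funD; exact: measurable_sum_cond.
have -> : e%:E = ((e / 3)%:E + ((e / 3)%:E + (e / 3)%:E))%E.
  by rewrite -!EFinD; congr EFin; lra.
apply: leeD; first by apply: HJ0; exact: leq_maxl.
apply: le_trans (L1_normD mu _ _) _; [exact: measurable_sum_cond|exact: measurable_sum_cond|].
apply: leeD.
  apply: le_trans (L1_norm_sum mu _ _ (fun j : 'I_J => mterm j)) _.
  apply: (@le_trans _ _ (\sum_(j < J) (e / 3 / J.+1%:R)%:E)%E).
    apply: lee_sum => j _; apply: HKj; rewrite leq_max; apply/orP; right.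
    exact: (leq_bigmax j).
  rewrite sumEFin lee_fin sumr_const card_ord -[leLHS]mulr_natr -(mulrA (e / 3)).
  rewrite ler_piMr ?(ltW e3)// mulrC ler_pdivrMr// mul1r ler_nat.
  exact: leqnSn.
apply: le_trans (L1_norm_sum mu _ _ (fun m : 'I_M => mtail m)) _.
apply: (@le_trans _ _ (\sum_(m < M | ~~ in_box J K m) `|nu m|%:E)%E).
  apply: lee_sum => m _; rewrite L1_normZ// normrN.
  rewrite -[leRHS]mule1; apply: lee_wpmul2l; first by rewrite lee_fin.
  exact: L1_norm_A.
rewrite sumEFin lee_fin; apply: le_trans (HM1 M M1M).
rewrite -(big_mkord (fun m => ~~ in_box J K m) (fun m => `|nu m|)).
rewrite (big_cat_nat (leq0n M1) M1M) /= big_nat_cond big1 ?add0r; last first.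
  move=> m /andP[/andP[_ mM1]]; rewrite nuE /in_box /unpair.
  case E : pickle_inv => [p|]//; have /andP[p1 p2] := HJ1 _ mM1 _ E.
  by rewrite !leq_max p1 p2 !orbT.
by rewrite big_mkcond /=; apply: ler_sum => m _; case: ifP.
Qed.

End decomposable.

(** * Nested partitions into cells *)

Section nested_cells.
Context d (T : measurableType d) (R : realType) (mu : {measure set T -> \bar R}).
Variables (key : nat -> T -> nat).

(** The dyadic cubes of generation K are encoded as the fibres of a function
    [key K] with values in [nat], so that a generation is countable and its cells
    are disjoint by construction. *)
Definition cell K x : set T := [set y | key K y = key K x].

Definition saturated : set (set T) := [set B | exists K S, B = key K @^-1` S].

Hypothesis key_nested : forall K x y, key K.+1 x = key K.+1 y -> key K x = key K y.
Hypothesis measurable_cell : forall K x, measurable (cell K x).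
Hypothesis saturated_generate : forall A : set T, measurable A ->
  <<s saturated >> A.

Lemma key_le k K x y : (k <= K)%N -> key K x = key K y -> key k x = key k y.
Proof.
move=> kK; rewrite -(subnK kK); elim: (K - k)%N => // m IH.
by rewrite addSn => /key_nested.
Qed.

Lemma eq_cell K x y : cell K x y -> cell K y = cell K x.
Proof. by rewrite /cell /= => ->. Qed.

Lemma subset_cell k K x : (k <= K)%N -> cell K x `<=` cell k x.
Proof. by move=> kK y /=; exact: key_le. Qed.

Lemma saturated_le k K (S : set nat) : (k <= K)%N ->
  exists S', key k @^-1` S = key K @^-1` S'.
Proof.
move=> kK; exists (key K @` (key k @^-1` S)); apply/seteqP; split=> [x Sx|x].
  by exists x.
by move=> [y Sy /(key_le kK) yx]; rewrite /= -yx.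
Qed.

Lemma setring_saturated : setring saturated.
Proof.
split; first by exists 0%N, set0; rewrite preimage_set0.
- move=> _ _ [k [S ->]] [K [S' ->]].
  have [U ->] := saturated_le S (leq_maxl k K).
  have [U' ->] := saturated_le S' (leq_maxr k K).
  by exists (maxn k K), (U `|` U').
- move=> _ _ [k [S ->]] [K [S' ->]].
  have [U ->] := saturated_le S (leq_maxl k K).
  have [U' ->] := saturated_le S' (leq_maxr k K).
  by exists (maxn k K), (U `\` U').
Qed.

(** A natural number need not be the key of a point. *)
Lemma fibreE K (S : set nat) i :
  [set x | key K x = i /\ S i] = set0 \/
  exists x, [set x | key K x = i /\ S i] = cell K x.
Proof.
have [[x [xi Si]]|none] := pselect (exists x, key K x = i /\ S i); last first.
  by left; rewrite -subset0 => x xS; apply: none; exists x.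
right; exists x; subst i; apply/seteqP; split=> [y [yx _]//|y yx].
by split.
Qed.

Lemma measurable_fibre K (S : set nat) i :
  measurable [set x | key K x = i /\ S i].
Proof.
by have [->|[x ->]] := fibreE K S i.
Qed.

Lemma saturated_fibres K (S : set nat) :
  key K @^-1` S = \bigcup_i [set x | key K x = i /\ S i].
Proof.
by apply/seteqP; split=> [x Sx|x [i _ [/= <- //]]]; exists (key K x).
Qed.

Lemma measurable_saturated B : saturated B -> measurable B.
Proof.
move=> [K [S ->]]; rewrite saturated_fibres.
by apply: bigcupT_measurable => i; exact: measurable_fibre.
Qed.

(** The sets over which [h] has a nonnegative integral form a monotone class.  It
    contains the countable unions of cells of one generation, which form a ring
    of sets because generations are nested; hence it contains every measurable
    set, in particular the set where [h] is negative. *)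
Lemma ae_ge0_of_cells (h : T -> R) : mu.-integrable setT (EFin \o h) ->
  (forall K x, 0 <= \int[mu]_(y in cell K x) (h y)%:E)%E ->
  {ae mu, forall x, 0 <= h x}.
Proof.
move=> ih hcell.
pose M := [set E : set T | measurable E /\
  (0 <= \int[mu]_(y in E) (h y)%:E)%E].
have satM : saturated `<=` M.
  move=> _ [K [S ->]]; split; first by apply: measurable_saturated; exists K, S.
  rewrite saturated_fibres integral_bigcup.
  - apply: nneseries_ge0 => i _ _.
    by have [->|[x ->]] := fibreE K S i; rewrite ?integral_set0//; exact: hcell.
  - by apply/trivIsetP => i j _ _ ij; rewrite -subset0 => x [[xi _] [xj _]];
      move/eqP: ij; apply; rewrite -xi -xj.
  - by move=> i; exact: measurable_fibre.
  - apply: integrableS ih => //.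
    by apply: bigcupT_measurable => i; exact: measurable_fibre.
have monoM : monotone M.
  split=> F ndF MF.
    have mF k : measurable (F k) by have [] := MF k.
    have mU : measurable (\bigcup_k F k) by exact: bigcupT_measurable.
    split=> //; apply: (cvge_to_ge (integral_eventually_cvg ih mF mU _)).
      move=> x; have [[k0 _ Fx]|Fx] := pselect ((\bigcup_k F k) x).
        exists k0 => // k /= k0k; split=> _; first by exists k0.
        by have /subsetPset := ndF _ _ k0k; apply.
      by exists 0%N => // k _; split=> // Fkx; exists k.
    by apply: nearW => k; exact: (MF k).2.
  have mF k : measurable (F k) by have [] := MF k.
  have mI : measurable (\bigcap_k F k) by exact: bigcapT_measurable.
  split=> //; apply: (cvge_to_ge (integral_eventually_cvg ih mF mI _)).
    move=> x; have [Fx|/existsNP[k0 /not_implyP[_ Fx]]] := pselect ((\bigcap_k F k) x).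
      by exists 0%N => // k _; split=> // _; exact: Fx.
    exists k0 => // k /= k0k; split=> [Fkx|]; last by move=> /(_ k0 I)/Fx.
    by have /subsetPset /(_ _ Fkx)/Fx := ndF _ _ k0k.
  by apply: nearW => k; exact: (MF k).2.
have allM E : measurable E -> M E.
  move=> /saturated_generate sE.
  apply: (monotone_setring_sub_g_sigma_ring monoM setring_saturated satM).
  have [sr0 srD srU] := smallest_sigma_ring saturated.
  move: E sE; apply: smallest_sub; last exact: sub_g_sigma_ring.
  split=> // B sB; apply: srD => //; apply: sub_g_sigma_ring.
  by exists 0%N, setT; rewrite preimage_setT.
have mh : measurable_fun setT h by apply/measurable_EFinP; exact: measurable_int ih.
pose E := [set x | h x < 0].
have mE : measurable E.
  have -> : E = h @^-1` `]-oo, 0[ by apply/seteqP; split=> x; rewrite /= in_itv.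
  by rewrite -[X in measurable X]setTI; exact: mh.
have hE0 : (\int[mu]_(x in E) `|(h x)%:E| = 0)%E.
  apply/eqP; rewrite eq_le integral_ge0// andbT.
  have -> : (\int[mu]_(x in E) `|(h x)%:E| = \int[mu]_(x in E) - (h x)%:E)%E.
    by apply: eq_integral => x; rewrite inE /E /= => hx; rewrite ltr0_norm.
  have ihE : mu.-integrable E (EFin \o h) by exact: integrableS ih.
  rewrite integralN//; last exact: integrable_add_def.
  by rewrite oppe_le0; have [] := allM _ mE.
have := (ae_eq_integral_abs mu mE _).1 hE0.
case=> [|N [mN N0 NE]]; first by apply/measurable_EFinP; exact: measurable_funS mh.
exists N; split=> // x /= hx; apply: NE => /= => hx0.
have Ex : E x by rewrite /E /= ltNge; apply/negP.
by move: (hx0 Ex) => -[hx00]; apply: hx; rewrite hx00.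
Qed.

End nested_cells.

(** * The stopping-time decomposition *)

(** The convex function y^q lies above its tangent at [t]; obtained from Young's
    inequality for [y] and t^(q-1). *)
Lemma young_tangent (R : realType) (q t y : R) : 1 < q -> 0 < t -> 0 <= y ->
  q * t `^ (q - 1) * y <= y `^ q + (q - 1) * t `^ q.
Proof.
move=> q1 t0 y0; have q0 : 0 < q by lra.
have qm : 0 < q - 1 by lra.
have pq : q^-1 + (q / (q - 1))^-1 = 1.
  by rewrite invf_div -{1}(mul1r q^-1) -mulrDl addrCA subrr addr0 divff ?gt_eqF.
have := conjugate_powR y0 (powR_ge0 t (q - 1)) q0 (divr_gt0 q0 qm) pq.
rewrite -powRrM mulrCA divff ?gt_eqF// mulr1 invf_div mulrA => H.
have qV : q * q^-1 = 1 by rewrite divff// gt_eqF.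
have -> : y `^ q + (q - 1) * t `^ q =
    q * (y `^ q * q^-1 + t `^ q * (q - 1) * q^-1).
  rewrite -[LHS]mulr1 -qV; lra.
by rewrite -mulrA (mulrC (t `^ _)) ler_pM2l.
Qed.

(** The dyadic cubes are used through four properties only: they are nested, they
    generate the sigma-algebra, all cells of generation K have the same measure
    [v K], and [v K] is [D] times [v K.+1]. *)
Section stopping_time.
Context d (T : measurableType d) (R : realType) (mu : {measure set T -> \bar R}).
Variables (key : nat -> T -> nat).
Hypothesis key_nested : forall K x y, key K.+1 x = key K.+1 y -> key K x = key K y.
Hypothesis measurable_cell : forall K x, measurable (cell key K x).
Hypothesis saturated_generate : forall A : set T, measurable A ->
  <<s saturated key >> A.
Variables (v : nat -> R) (D : R).
Hypothesis v_gt0 : forall K, 0 < v K.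
Hypothesis mu_cell : forall K x, mu (cell key K x) = (v K)%:E.
Hypothesis v_ratio : forall K, v K = D * v K.+1.
Hypothesis D_ge1 : 1 <= D.
Variables (x0 : T) (a : T -> R) (q alpha : R).
Hypothesis a_integrable : mu.-integrable setT (EFin \o a).
Hypothesis a_supp : forall x, ~ cell key 0 x0 x -> a x = 0.
Hypothesis a_mean : \int[mu]_(x in cell key 0 x0) a x = 0.
Hypothesis q_gt1 : 1 < q.
Hypothesis alpha_gt0 : 0 < alpha.
Hypothesis a_power :
  (\int[mu]_x (`|a x| `^ q)%:E <= (alpha `^ q * v 0)%:E)%E.

Local Notation Q := (cell key).

Let measurable_a : measurable_fun setT a.
Proof. by apply/measurable_EFinP; exact: measurable_int a_integrable. Qed.

Let measurable_norm_a : measurable_fun setT (EFin \o (fun x => `|a x| : R)).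
Proof. by apply/measurable_EFinP; exact: measurableT_comp. Qed.

Let a_integrable_on A : measurable A -> mu.-integrable A (EFin \o a).
Proof. by move=> mA; exact: integrableS a_integrable. Qed.

Definition mass (A : set T) : R := \int[mu]_(x in A) `|a x|.

Lemma massE A : measurable A ->
  (\int[mu]_(x in A) `|a x|%:E = (mass A)%:E)%E.
Proof.
move=> mA; rewrite /mass /Rintegral fineK//; apply: integrable_fin_num => //.
exact: (integrable_norm (a_integrable_on mA)).
Qed.

Lemma mass_ge0 A : 0 <= mass A.
Proof. by apply: Rintegral_ge0. Qed.

Lemma le_mass A B : measurable A -> measurable B -> A `<=` B ->
  mass A <= mass B.
Proof.
move=> mA mB AB; rewrite -lee_fin -!massE//; apply: ge0_subset_integral => //.
exact: measurable_funS measurable_norm_a.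
Qed.

Definition avg K x : R := (v K)^-1 * \int[mu]_(y in Q K x) a y.

(** The height 0 at j = 0 selects every cell of generation 0 on which [a] does not
    vanish, so that the decomposition starts from the zero function. *)
Definition threshold j : R := if j is 0 then 0 else alpha * 2 ^+ j.

Lemma threshold_ge0 j : 0 <= threshold j.
Proof. by case: j => //= j; rewrite mulr_ge0 ?exprn_ge0 ?ltW. Qed.

Lemma le_threshold j : threshold j <= threshold j.+1.
Proof.
case: j => [|j]; first exact: threshold_ge0.
by rewrite /= ler_pM2l// [leRHS]exprS ler_peMl ?exprn_ge0// ler1n.
Qed.

Definition bad j K x : bool := threshold j * v K < mass (Q K x).

Definition stops j K x : bool :=
  bad j K x && [forall i : 'I_K, ~~ bad j i x].

(** The maximal bad cells at height j, indexed by the code of their generation and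
    key, hence pairwise disjoint; most codes give the empty set. *)
Definition piece j m : set T :=
  [set x | exists2 K, stops j K x & m = pickle (K, key K x)].

Definition stopped j x : R :=
  if pselect (exists K, stops j K x) is left e then avg (projT1 (cid e)) x
  else a x.

Lemma bad_cell j k K x y : (k <= K)%N -> Q K x y -> bad j k y = bad j k x.
Proof.
by move=> kK /(subset_cell key_nested kK) xy; rewrite /bad (eq_cell xy).
Qed.

Lemma stops_cell j K x y : Q K x y -> stops j K y = stops j K x.
Proof.
move=> xy; rewrite /stops (bad_cell _ (leqnn K) xy); congr (_ && _).
by apply: eq_forallb => i; rewrite (bad_cell _ (ltnW (ltn_ord i)) xy).
Qed.

Lemma not_bad_before j K x k : stops j K x -> (k < K)%N -> ~~ bad j k x.
Proof. by move=> /andP[_ /forallP H] kK; exact: (H (Ordinal kK)). Qed.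

Lemma stops_uniq j K K' x : stops j K x -> stops j K' x -> K = K'.
Proof.
have le L L' : stops j L x -> stops j L' x -> (L <= L')%N.
  move=> sL sL'; have bL' : bad j L' x by case/andP: sL'.
  rewrite leqNgt; apply/negP => LL'.
  by have /negP := not_bad_before sL LL'; apply.
by move=> sK sK'; apply/anti_leq; rewrite le// le.
Qed.

Lemma bad_stops j K x : bad j K x -> exists2 K', stops j K' x & (K' <= K)%N.
Proof.
move=> bK; have e : exists K, bad j K x by exists K.
case: (ex_minnP e) => K' bK' K'min; exists K'; last exact: K'min.
rewrite /stops bK'; apply/forallP => i; apply/negP => /K'min.
by rewrite leqNgt ltn_ord.
Qed.

Lemma bad_le j K x : bad j.+1 K x -> bad j K x.
Proof. by apply: le_lt_trans; rewrite ler_pM2r// le_threshold. Qed.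

Lemma piece_cell j m x : piece j m x ->
  exists2 K, stops j K x & piece j m = Q K x.
Proof.
move=> [K sK ->]; exists K => //; apply/seteqP; split=> [y [L sL]|y xy].
  by move=> /(pcan_inj pickleK)[KL]; subst L => /esym.
by exists K; [rewrite (stops_cell _ xy)|rewrite (xy : key K y = key K x)].
Qed.

Lemma pieceP j m : piece j m = set0 \/
  exists K x, stops j K x /\ piece j m = Q K x.
Proof.
have [[x xm]|none] := pselect (exists x, piece j m x); last first.
  by left; rewrite -subset0 => x xm; apply: none; exists x.
by right; have [K ? ?] := piece_cell xm; exists K, x.
Qed.

Lemma measurable_piece j m : measurable (piece j m).
Proof.
have [->//|[K [x [_ ->]]]] := pieceP j m; exact: measurable_cell.
Qed.

Lemma trivIset_piece j : trivIset setT (piece j).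
Proof.
apply/trivIsetP => m m' _ _ /eqP mm'; rewrite -subset0 => x [[K sK mE]].
by move=> [K' sK' m'E]; apply: mm'; rewrite mE m'E (stops_uniq sK sK').
Qed.

Lemma not_pieceP j x : ~ (\bigcup_m piece j m) x <-> forall K, ~~ bad j K x.
Proof.
split=> [np K|nb [m _ [K /andP[bK _] _]]]; last by have := nb K; rewrite bK.
apply/negP => /bad_stops[K' sK' _]; apply: np.
by exists (pickle (K', key K' x)) => //; exists K'.
Qed.

Lemma stoppedE j K x : stops j K x -> stopped j x = avg K x.
Proof.
rewrite /stopped => sK; case: pselect => [e|]; last by case; exists K.
by case: cid => K' /= /(stops_uniq sK) ->.
Qed.

Lemma stopped_cell j K x y : stops j K x -> Q K x y ->
  stopped j y = avg K x.
Proof.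
move=> sK xy; rewrite (@stoppedE j K) ?(stops_cell _ xy)//.
by rewrite /avg (eq_cell xy).
Qed.

Lemma stopped_out j x : ~ (\bigcup_m piece j m) x -> stopped j x = a x.
Proof.
move=> /not_pieceP nb; rewrite /stopped; case: pselect => // e; exfalso.
by case: e => K sK; have := nb K; case/andP: sK => ->.
Qed.

Lemma measurable_pieces j : measurable (\bigcup_m piece j m).
Proof. by apply: bigcupT_measurable => m; exact: measurable_piece. Qed.

Lemma measurable_stopped j : measurable_fun setT (stopped j).
Proof.
rewrite -(setvU (\bigcup_m piece j m)).
apply/measurable_funU; [exact: measurableC (measurable_pieces j)
  |exact: measurable_pieces|split].
  apply: (@eq_measurable_fun _ _ _ _ _ a); last exact: measurable_funS measurable_a.
  by move=> x; rewrite inE => /stopped_out.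
apply/measurable_fun_bigcup => m; first exact: measurable_piece.
have [->|[K [x [sK ->]]]] := pieceP j m; first exact: measurable_fun_set0.
apply: (@eq_measurable_fun _ _ _ _ _ (cst (avg K x))); last exact: measurable_cst.
by move=> y; rewrite inE => /(stopped_cell sK).
Qed.

Let integrable_cst_cell K x (c : R) : mu.-integrable (Q K x) (EFin \o cst c).
Proof.
apply/integrableP; split; first exact/measurable_EFinP.
rewrite /= integral_cst; last exact: measurable_cell.
by rewrite mu_cell -EFinM ltry.
Qed.

Let integrable_indic_cell K x :
  mu.-integrable setT (fun y => (\1_(Q K x) y : R)%:E).
Proof.
by apply: integrable_indic_lty; [exact: measurable_cell|rewrite mu_cell ltry].
Qed.

(** By nestedness a cell is either inside the base cell or disjoint from it, and in
    the latter case [a] vanishes on it ([cell_off_base]). *)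
Lemma cell_base K x : Q 0 x0 x -> Q K x `<=` Q 0 x0.
Proof.
move=> Qx y xy; rewrite -(eq_cell Qx).
exact: (subset_cell key_nested (leq0n K)).
Qed.

Lemma cell_off_base K x y : ~ Q 0 x0 x -> Q K x y -> a y = 0.
Proof.
move=> Qx xy; apply: a_supp => Qy; apply: Qx; rewrite -(eq_cell Qy).
by apply: (subset_cell key_nested (leq0n K)); exact: esym.
Qed.

(** Put h = threshold on the base cell, minus |a| off the bad cells.  A cell that
    is not contained in a bad one meets a point of which no cell is bad, so the
    average of |a| on it is at most the threshold: the integral of h over every
    cell is nonnegative, and so is h almost everywhere. *)
Lemma ae_le_threshold j : {ae mu, forall x,
  ~ (\bigcup_m piece j m) x -> `|a x| <= threshold j}.
Proof.
pose Q0 := Q 0 x0; pose G := ~` (\bigcup_m piece j m).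
have mQ0 : measurable Q0 by exact: measurable_cell.
have mG : measurable G by apply: measurableC; exact: measurable_pieces.
pose h x : R := threshold j * \1_Q0 x - `|a x| * \1_G x.
have ih : mu.-integrable setT (EFin \o h).
  rewrite (_ : EFin \o h = (fun x => (threshold j)%:E * (\1_Q0 x)%:E) \-
      (fun x => `|a x|%:E * (\1_G x)%:E))%E; last first.
    by apply/funext => x; rewrite /h /= EFinB !EFinM.
  apply: integrableB => //.
    by apply: integrableZl => //; exact: integrable_indic_cell.
  apply: (le_integrable _ _ _ (integrable_norm a_integrable)) => //.
    rewrite (_ : (fun x => _) = EFin \o (fun x => `|a x| * \1_G x)).
      apply/measurable_EFinP; apply: measurable_funM => //.
      exact: measurableT_comp.
    by apply/funext => x; rewrite /= EFinM.
  move=> x _ /=; rewrite lee_fin normrM normr_id normr_nat ler_piMr//.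
  by case: (_ \in _).
have ge0_on (A : set T) : (forall x, A x -> 0 <= h x) ->
    (0 <= \int[mu]_(x in A) (h x)%:E)%E.
  by move=> hA; apply: integral_ge0 => x Ax; rewrite lee_fin hA.
have hcell K x : (0 <= \int[mu]_(y in Q K x) (h y)%:E)%E.
  have [Qx|Qx] := pselect (Q0 x); last first.
    apply: ge0_on => y xy; rewrite /h (cell_off_base Qx xy) normr0 mul0r subr0.
    by rewrite mulr_ge0// threshold_ge0.
  have Qcell y : Q K x y -> Q0 y := @cell_base K x Qx y.
  have [[y [xy Gy]]|none] := pselect (exists y, Q K x y /\ G y); last first.
    apply: ge0_on => y xy; rewrite /h !indicE (@memNset _ G) ?mulr0 ?subr0.
      by rewrite mulr_ge0// threshold_ge0.
    by move=> Gy; apply: none; exists y.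
  have /not_pieceP/(_ K) := Gy; rewrite (bad_cell _ (leqnn K) xy) /bad -leNgt.
  move=> small.
  have mC : measurable (Q K x) by exact: measurable_cell.
  apply: (@le_trans _ _
      (\int[mu]_(y in Q K x) (threshold j - `|a y|)%:E)%E).
    rewrite integralB_EFin//; [|exact: integrable_cst_cell|];
      last exact: (integrable_norm (a_integrable_on mC)).
    rewrite integral_cst// massE// mu_cell -EFinM -EFinB lee_fin.
    by rewrite subr_ge0.
  apply: le_integral => //.
  - exact: (integrableB mC (integrable_cst_cell K x (threshold j))
      (integrable_norm (a_integrable_on mC))).
  - exact: integrableS ih.
  move=> z; rewrite inE => /Qcell Qz; rewrite lee_fin /h indicE mem_set// mulr1.
  by rewrite lerB// ler_piMr// indicE; case: (_ \in _).
have := ae_ge0_of_cells key_nested measurable_cell saturated_generate ih hcell.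
apply: filterS => x hx Gx.
have [Qx|Qx] := pselect (Q0 x); last first.
  by rewrite a_supp// normr0 threshold_ge0.
by move: hx; rewrite /h !indicE !mem_set// !mulr1 subr_ge0.
Qed.

Lemma avg0 x : avg 0 x = 0.
Proof.
rewrite /avg; have [Qx|Qx] := pselect (Q 0 x0 x).
  by rewrite (eq_cell Qx) a_mean mulr0.
rewrite (@eq_Rintegral _ _ _ _ _ (cst 0)).
  by rewrite Rintegral_cst ?mul0r ?mulr0//; exact: measurable_cell.
by move=> y; rewrite inE => /(cell_off_base Qx).
Qed.

Lemma norm_avg_le K x : `|avg K x| <= (v K)^-1 * mass (Q K x).
Proof.
rewrite normrM gtr0_norm ?invr_gt0// ler_pM2l ?invr_gt0//.
apply: le_normr_Rintegral; first exact: measurable_cell.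
exact: a_integrable_on.
Qed.

(** On a maximal bad cell the parent is not bad, and passing to the parent costs
    the ratio [D] of the measures.  A bad cell of generation 0 has no parent, but
    there the average of [a] is 0. *)
Lemma ae_stopped_le j : {ae mu, forall x, `|stopped j x| <= D * threshold j}.
Proof.
apply: filterS (ae_le_threshold j) => x ax.
have [[K sK]|none] := pselect (exists K, stops j K x); last first.
  have nx : ~ (\bigcup_m piece j m) x.
    by move=> [m _ [K sK _]]; apply: none; exists K.
  rewrite stopped_out//; apply: le_trans (ax nx) _.
  by rewrite ler_peMl ?threshold_ge0.
rewrite (stoppedE sK); case: K sK => [|K] sK.
  by rewrite avg0 normr0 mulr_ge0 ?threshold_ge0// (le_trans ler01).
have := not_bad_before sK (ltnSn K); rewrite /bad -leNgt => parent.
apply: le_trans (norm_avg_le _ _) _.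
rewrite ler_pdivrMl// mulrA (mulrC (v _)) -v_ratio mulrC; apply: le_trans parent.
apply: le_mass; [exact: measurable_cell|exact: measurable_cell|].
by apply: subset_cell.
Qed.

Let mass_piece_le j m (K : nat) x :  piece j m = Q K x ->
  (\int[mu]_(y in piece j m) `|avg K x - a y|%:E <= (2 * mass (piece j m))%:E)%E.
Proof.
move=> ->; have mC : measurable (Q K x) by exact: measurable_cell.
apply: (@le_trans _ _
  (\int[mu]_(y in Q K x) (`|avg K x|%:E + `|a y|%:E))%E).
  apply: ge0_le_integral => //.
  - apply/measurable_EFinP; apply: measurableT_comp => //.
    by apply: measurable_funB => //; exact: measurable_funS measurable_a.
  - apply/measurable_EFinP; apply: measurable_funD => //.
    by apply: measurableT_comp => //; exact: measurable_funS measurable_a.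
  - by move=> y _; rewrite -EFinD lee_fin; exact: ler_normB.
rewrite ge0_integralD//; last first.
  by apply/measurable_EFinP; apply: measurableT_comp => //;
     exact: measurable_funS measurable_a.
rewrite integral_cst// massE// mu_cell -EFinM -EFinD lee_fin.
rewrite mulrDl !mul1r lerD2r -ler_pdivlMr// mulrC; exact: norm_avg_le.
Qed.

Lemma integral_avg K x :
  \int[mu]_(y in Q K x) (avg K x - a y) = 0.
Proof.
have mC : measurable (Q K x) by exact: measurable_cell.
rewrite RintegralB//; [|exact: integrable_cst_cell|exact: a_integrable_on].
rewrite Rintegral_cst// mu_cell /avg /= mulrC mulrA divff ?gt_eqF//.
by rewrite mul1r subrr.
Qed.

Definition error j x := stopped j x - a x.

Let measurable_error j : measurable_fun setT (error j).
Proof. by apply: measurable_funB => //; exact: measurable_stopped. Qed.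

Lemma sum_mass_piece j : (\sum_(0 <= m <oo) (mass (piece j m))%:E <=
  \int[mu]_x `|a x|%:E)%E.
Proof.
rewrite (eq_eseriesr (g := fun m => \int[mu]_(x in piece j m) `|a x|%:E)%E);
  last by move=> m _; rewrite massE//; exact: measurable_piece.
rewrite -ge0_integral_bigcup//.
- apply: ge0_subset_integral => //; exact: measurable_pieces.
- by move=> m; exact: measurable_piece.
- exact: measurable_funS measurable_norm_a.
- exact: trivIset_piece.
Qed.

Lemma L1_norm_error j : (L1_norm mu (error j) <=
  2%:E * \sum_(0 <= m <oo) (mass (piece j m))%:E)%E.
Proof.
pose U := \bigcup_m piece j m.
have mU : measurable U by exact: measurable_pieces.
have -> : L1_norm mu (error j) = (\int[mu]_(x in U) `|error j x|%:E)%E.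
  apply: integral_supported => // x /stopped_out.
  by rewrite /error => ->; rewrite subrr normr0.
rewrite ge0_integral_bigcup//.
- rewrite -nneseriesZl//; last by move=> m _; rewrite lee_fin mass_ge0.
  apply: lee_nneseries => [m _ _|m _ ]; first by apply: integral_ge0.
  have [->|[K [x [sK pE]]]] := pieceP j m.
    by rewrite integral_set0 /mass Rintegral_set0 mule0.
  rewrite -EFinM; apply: le_trans (mass_piece_le pE).
  rewrite le_eqVlt; apply/orP; left; apply/eqP; apply: eq_integral => y.
  by rewrite inE pE => xy; rewrite /error (stopped_cell sK xy).
- by move=> m; exact: measurable_piece.
- apply/measurable_EFinP; apply: measurableT_comp => //.
  exact: measurable_funS (measurable_error j).
- exact: trivIset_piece.
Qed.

Lemma integrable_error j : mu.-integrable setT (EFin \o error j).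
Proof.
apply/integrableP; split; first exact/measurable_EFinP.
apply: le_lt_trans (L1_norm_error j) _.
apply: lte_mul_pinfty => //.
apply: le_lt_trans (sum_mass_piece j) _.
by have [_] := integrableP _ _ _ a_integrable.
Qed.

Lemma integrable_stopped j : mu.-integrable setT (EFin \o stopped j).
Proof.
rewrite (_ : EFin \o _ = (EFin \o a) \+ (EFin \o error j))%E.
  by apply: integrableD => //; exact: integrable_error.
by apply/funext => x /=; rewrite -EFinD /error addrCA subrr addr0.
Qed.

(** A cell without bad ancestors is, up to the set where [stopped i] and [a]
    coincide, a disjoint union of maximal bad cells, and on each of these
    averaging preserves the integral. *)
Lemma integral_error i K x : (forall k, (k < K)%N -> ~~ bad i k x) ->
  (\int[mu]_(y in Q K x) (error i y)%:E = 0)%E.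
Proof.
move=> nb; have mC : measurable (Q K x) by exact: measurable_cell.
pose U := \bigcup_m (Q K x `&` piece i m).
have mCP m : measurable (Q K x `&` piece i m).
  by apply: measurableI => //; exact: measurable_piece.
have -> : (\int[mu]_(y in Q K x) (error i y)%:E =
    \int[mu]_(y in U) (error i y)%:E)%E.
  rewrite integral_mkcond [RHS]integral_mkcond.
  apply: eq_integral => y _; rewrite /patch /U -setI_bigcupr in_setI.
  case: (y \in Q K x) => //=; case: ifPn => //.
  by rewrite notin_setE => /stopped_out; rewrite /error => ->; rewrite subrr.
rewrite integral_bigcup//; first last.
- apply: integrableS (integrable_error i) => //; exact: bigcupT_measurable.
- apply: trivIset_setIl; exact: trivIset_piece.
apply: eseries0 => m _ _.
have [[y [xy py]]|none] := pselect ((Q K x `&` piece i m) !=set0); last first.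
  rewrite (_ : _ `&` _ = set0) ?integral_set0//.
  by rewrite -subset0 => y yP; apply: none; exists y.
have [L sL pE] := piece_cell py.
have KL : (K <= L)%N.
  rewrite leqNgt; apply/negP => LK; have := nb _ LK.
  rewrite -(bad_cell _ (ltnW LK) xy); by case/andP: sL => ->.
have -> : Q K x `&` piece i m = Q L y.
  rewrite pE; apply: setIidr => z yz.
  by rewrite -(eq_cell xy); exact: (subset_cell key_nested KL).
have : (\int[mu]_(z in Q L y) (error i z)%:E =
    (\int[mu]_(z in Q L y) (avg L y - a z))%:E)%E.
  rewrite /Rintegral fineK; last first.
    apply: integrable_fin_num; first exact: measurable_cell.
    apply: (integrableB (measurable_cell L y) (integrable_cst_cell L y (avg L y))
      (a_integrable_on (measurable_cell L y))).
  by apply: eq_integral => z; rewrite inE => yz; rewrite /error (stopped_cell sL yz).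
by rewrite integral_avg.
Qed.

Let measurable_power : measurable_fun setT (fun x => `|a x| `^ q).
Proof. exact: measurable_norm_powR. Qed.

(** A form of Jensen's inequality: integrate the tangent inequality at [t] over
    [P] and absorb the constant term, as [t * mu P] is at most the mass. *)
Lemma mass_power P (w t : R) : measurable P -> mu P = w%:E -> 0 < t ->
  t * w <= mass P ->
  ((t `^ (q - 1) * mass P)%:E <= \int[mu]_(x in P) (`|a x| `^ q)%:E)%E.
Proof.
move=> mP muP t0 tw.
have q0 : 0 < q by apply: lt_trans q_gt1.
have mpP : measurable_fun P (fun x => `|a x| `^ q).
  exact: measurable_funS measurable_power.
have mnP : measurable_fun P (fun x => `|a x|).
  by apply: measurableT_comp => //; exact: measurable_funS measurable_a.
pose I := (\int[mu]_(x in P) (`|a x| `^ q)%:E)%E.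
have Ilt : (I < +oo)%E.
  apply: le_lt_trans (ltry (alpha `^ q * v 0)); apply: le_trans a_power.
  by apply: ge0_subset_integral => //; exact/measurable_EFinP.
have I0 : (0 <= I)%E by apply: integral_ge0 => x _; rewrite lee_fin powR_ge0.
have Ifin : I \is a fin_num by rewrite ge0_fin_numE.
have : ((q * t `^ (q - 1) * mass P)%:E <= I + ((q - 1) * t `^ q * w)%:E)%E.
  rewrite EFinM -massE// -ge0_integralZl//; last 2 first.
  - exact/measurable_EFinP.
  - by rewrite lee_fin mulr_ge0 ?powR_ge0 ?ltW.
  rewrite [((q - 1) * _ * w)%:E]EFinM -muP -(integral_cst mu mP).
  rewrite -ge0_integralD//; last 2 first.
  - exact/measurable_EFinP.
  - by move=> x _; rewrite lee_fin mulr_ge0 ?powR_ge0// subr_ge0 ltW.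
  apply: ge0_le_integral => //.
  - by move=> x _; rewrite -EFinM lee_fin mulr_ge0// mulr_ge0 ?powR_ge0 ?ltW.
  - by apply/measurable_EFinP; apply: measurable_funM.
  - by apply/measurable_EFinP; apply: measurable_funD.
  - by move=> x _; rewrite -EFinM -EFinD lee_fin; exact: young_tangent.
rewrite -/I -(fineK Ifin) -EFinD !lee_fin => H.
have tq : t `^ q = t `^ (q - 1) * t.
  by rewrite -{3}(powRr1 (ltW t0)) -powRD ?subrK// gt_eqF// implybT.
have : (q - 1) * t `^ q * w <= (q - 1) * (t `^ (q - 1) * mass P).
  rewrite tq -!mulrA ler_pM2l ?subr_gt0//.
  by rewrite ler_wpM2l ?powR_ge0.
move: H; rewrite -(mulrA q); set X := t `^ (q - 1) * _; lra.
Qed.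

(** The mass of the bad cells decays by this factor when the height doubles. *)
Definition ratio : R := 2 `^ (1 - q).

Lemma sum_mass_piece_power j : (\sum_(0 <= m <oo) (mass (piece j.+1 m))%:E <=
  (alpha * v 0 * ratio ^+ j.+1)%:E)%E.
Proof.
pose t := threshold j.+1.
have t0 : 0 < t by rewrite /t /= mulr_gt0 ?exprn_gt0.
have tq0 : 0 < t `^ (q - 1) by rewrite powR_gt0.
rewrite -(@lee_pmul2l _ (t `^ (q - 1))%:E)//.
rewrite -nneseriesZl; last by move=> m _; rewrite lee_fin mass_ge0.
apply: (@le_trans _ _
    (\sum_(0 <= m <oo) \int[mu]_(x in piece j.+1 m) (`|a x| `^ q)%:E)%E).
  apply: lee_nneseries => [m _ _|m _].
    by rewrite -EFinM lee_fin mulr_ge0 ?mass_ge0 ?ltW.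
  have [->|[K [x [sK pE]]]] := pieceP j.+1 m.
    by rewrite integral_set0 /mass Rintegral_set0 mule0.
  rewrite -EFinM; apply: (@mass_power _ (v K)) => //.
  - exact: measurable_piece.
  - by rewrite pE mu_cell.
  - by rewrite pE ltW//; case/andP: sK.
rewrite -ge0_integral_bigcup//; last 3 first.
- by move=> m; exact: measurable_piece.
- exact/measurable_EFinP/(measurable_funS measurableT _ measurable_power).
- exact: trivIset_piece.
apply: (@le_trans _ _ (\int[mu]_x (`|a x| `^ q)%:E)%E).
  apply: ge0_subset_integral => //; first exact: measurable_pieces.
  exact/measurable_EFinP.
apply: le_trans a_power _; rewrite -EFinM lee_fin.
have -> : t `^ (q - 1) * (alpha * v 0 * ratio ^+ j.+1) = alpha `^ q * v 0.
  rewrite /t /threshold powRM ?exprn_ge0 ?ltW//.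
  have -> : (2 ^+ j.+1) `^ (q - 1) = (ratio ^+ j.+1)^-1.
    rewrite -powR_mulrn// powRAC powR_mulrn ?powR_ge0// -exprVn.
    by rewrite -powRN opprB.
  have aq : alpha `^ q = alpha `^ (q - 1) * alpha.
    rewrite -{3}(powRr1 (ltW alpha_gt0)) -powRD ?subrK//.
    by apply/implyP => _; rewrite gt_eqF.
  rewrite aq; set r := ratio ^+ j.+1.
  have rV : r / r = 1 by rewrite divff// gt_eqF// exprn_gt0// powR_gt0.
  transitivity (alpha `^ (q - 1) * alpha * v 0 * (r / r)); first by lra.
  by rewrite rV mulr1.
by [].
Qed.

Lemma ratio_lt1 : 0 < ratio < 1.
Proof.
rewrite powR_gt0//= /ratio /powR gt_eqF// expR_lt1 pmulr_llt0 ?subr_lt0//.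
by rewrite ln_gt0// ltr1n.
Qed.

Lemma threshold_mu_le_mass j m :
  ((threshold j)%:E * mu (piece j m) <= (mass (piece j m))%:E)%E.
Proof.
have [->|[K [x [sK pE]]]] := pieceP j m.
  by rewrite measure0 mule0 lee_fin mass_ge0.
rewrite pE (mu_cell K x : mu (Q K x) = _) -EFinM lee_fin ltW//.
by case/andP: sK.
Qed.

Lemma piece_base m : piece 0 m `<=` Q 0 x0.
Proof.
have [->//|[K [x [sK ->]]]] := pieceP 0 m.
have [Qx|Qx] := pselect (Q 0 x0 x); first exact: cell_base.
case/andP: sK; rewrite /bad /threshold mul0r /mass.
rewrite (@eq_Rintegral _ _ _ _ _ (cst 0)).
  by rewrite Rintegral_cst ?mul0r ?ltxx//; exact: measurable_cell.
by move=> y; rewrite inE => /(cell_off_base Qx) ->; rewrite normr0.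
Qed.

(** For j = 0 the pieces lie in the base cell, whose measure is [v 0]; otherwise the
    measure of a piece is controlled by its mass through badness. *)
Lemma sum_threshold_mu j : ((threshold j.+1)%:E *
  \sum_(0 <= m <oo) mu (piece j m) <= (2 * (alpha * v 0 * ratio ^+ j))%:E)%E.
Proof.
case: j => [|j].
  have -> : threshold 1 = 2 * alpha by rewrite /threshold expr1 mulrC.
  rewrite expr0 mulr1 mulrA [leRHS]EFinM lee_pmul2l ?lte_fin ?mulr_gt0//.
  have -> : (\sum_(0 <= m <oo) mu (piece 0 m) = mu (\bigcup_m piece 0 m))%E.
    rewrite measure_bigcup//; last exact: trivIset_piece.
      by apply: eq_eseriesl => m; rewrite in_setT.
    by move=> m _; exact: measurable_piece.
  rewrite -(mu_cell 0 x0).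
  apply: le_measure; rewrite ?inE.
  - exact: measurable_pieces.
  - exact: measurable_cell.
  - by move=> x [m _ /piece_base].
have -> : threshold j.+2 = 2 * threshold j.+1 by rewrite /threshold exprS mulrCA.
rewrite [leRHS]EFinM [(2 * _)%:E]EFinM -muleA lee_pmul2l// -nneseriesZl//.
apply: le_trans (sum_mass_piece_power j).
apply: lee_nneseries => [m _ _|m _]; last exact: threshold_mu_le_mass.
by rewrite mule_ge0// lee_fin threshold_ge0.
Qed.

Definition delta j x := stopped j.+1 x - stopped j x.

Lemma integrable_delta j : mu.-integrable setT (EFin \o delta j).
Proof.
rewrite (_ : EFin \o _ = (EFin \o stopped j.+1) \- (EFin \o stopped j))%E.
  by apply: integrableB => //; exact: integrable_stopped.
by apply/funext.
Qed.

Lemma ae_delta_le j : {ae mu, forall x, `|delta j x| <= 2 * D * threshold j.+1}.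
Proof.
apply: filterS2 (ae_stopped_le j) (ae_stopped_le j.+1) => x H1 H2.
apply: le_trans (ler_normB _ _) _; rewrite -mulrA mulrDl !mul1r lerD//.
by apply: le_trans H1 _; rewrite ler_wpM2l ?le_threshold// (le_trans ler01).
Qed.

(** A bad cell at height j.+1 is bad at height j, so off the pieces of height j
    neither function has been modified. *)
Lemma delta_out j x : ~ (\bigcup_m piece j m) x -> delta j x = 0.
Proof.
move=> nx; rewrite /delta !stopped_out ?subrr//.
by apply/not_pieceP => K; move/not_pieceP: nx => /(_ K); apply: contra => /bad_le.
Qed.

(** A maximal bad cell at height j has no bad ancestor at height j, nor a fortiori
    at height j.+1, so both averaged functions have there the integral of [a]. *)
Lemma integral_delta j m : (\int[mu]_(x in piece j m) (delta j x)%:E = 0)%E.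
Proof.
have [->|[K [x [sK ->]]]] := pieceP j m; first by rewrite integral_set0.
have mC : measurable (Q K x) by exact: measurable_cell.
rewrite (_ : (fun y => _) =
    (fun y => (error j.+1 y)%:E - (error j y)%:E)%E); last first.
  apply/funext => y; rewrite -EFinB; congr EFin; rewrite /delta /error; lra.
rewrite integralB_EFin//; [|exact: integrableS (integrable_error _)
  |exact: integrableS (integrable_error _)].
rewrite !integral_error ?sube0// => k kK; first exact: not_bad_before sK kK.
by apply: contra (not_bad_before sK kK); exact: bad_le.
Qed.

(** The sum telescopes to [stopped J], as [stopped 0] vanishes almost everywhere,
    and the L^1 distance to [a] is at most twice the mass of the bad cells. *)
Lemma cvg_sum_delta : (fun J => L1_norm mu
  (fun x => a x - \sum_(j < J) delta j x)) @ \oo --> 0%E.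
Proof.
have g0 : {ae mu, forall x, stopped 0 x = 0}.
  apply: filterS (ae_stopped_le 0) => x.
  by rewrite mulr0 normr_le0 => /eqP.
have sumE J x : \sum_(j < J) delta j x = stopped J x - stopped 0 x.
  by rewrite -(big_mkord xpredT (fun j => delta j x)) telescope_sumr.
have E J : L1_norm mu (fun x => a x - \sum_(j < J) delta j x) =
    L1_norm mu (error J).
  under [in LHS]eq_fun do rewrite sumE.
  rewrite (@ae_eq_L1_norm _ _ _ _ _ (fun x => -1 * error J x)).
  - by rewrite L1_normZ// normrN normr1 mul1e.
  - apply: measurable_funB => //; apply: measurable_funB;
      exact: measurable_stopped.
  - exact: measurable_funM.
  - by apply: filterS g0 => x; rewrite /error => ->; lra.
under eq_fun do rewrite E.
apply/cvge0P => [J|e e0]; first exact: L1_norm_ge0.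
have c0 : 0 < 2 * (alpha * v 0) by rewrite !mulr_gt0.
have /andP[r0 r1] := ratio_lt1.
have [N _ HN] : \forall J \near \oo, ratio ^+ J < e / (2 * (alpha * v 0)).
  have rc : (fun J => ratio ^+ J) @ \oo --> (0 : R).
    by apply: cvg_expr; rewrite gtr0_norm.
  exact: (cvgr_lt _ rc _ (divr_gt0 e0 c0)).
exists N.+1 => -[//|J] NJ; apply: le_trans (L1_norm_error _) _.
apply: (@le_trans _ _ (2%:E * (alpha * v 0 * ratio ^+ J.+1)%:E)%E).
  by rewrite lee_pmul2l ?lte_fin//; exact: sum_mass_piece_power.
rewrite -EFinM lee_fin mulrA mulrC -ler_pdivlMr//; apply/ltW/HN => /=.
exact: ltnW.
Qed.

End stopping_time.

(** * Dyadic cubes of R^n *)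

Section boxes.
Context {R : realType}.

(** Products of sets of reals: closed cubes and half-open dyadic cubes are both of
    this form, which gives their measures at once. *)
Definition box n (I : 'I_n -> set R) : set (Rn R n) :=
  [set x | forall i, I i (tnth x i)].

Lemma measurable_box n (I : 'I_n -> set R) :
  (forall i, measurable (I i : set (measurableTypeR R))) -> measurable (box I).
Proof.
move=> mI; rewrite (_ : box I = \bigcap_(i in setT) (fun x => tnth x i) @^-1` I i).
  apply: fin_bigcap_measurable => // i _.
  by rewrite -[X in measurable X]setTI; exact: measurable_tnth.
by apply/seteqP; split=> [x Ix i _|x Ix i]; [exact: Ix|exact: (Ix i)].
Qed.

Lemma lebesgue_Rn_box n (I : 'I_n -> set R) (L : R) :
  (forall i, measurable (I i : set (measurableTypeR R))) ->
  (forall i, lebesgue_measure (I i) = L%:E) ->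
  lebesgue_Rn R n (box I) = (L ^+ n)%:E.
Proof.
elim: n I => [|n IH] I mI LI.
  rewrite /= diracE expr0 mem_set//; by case.
rewrite /= /lebesgue_Rn_step /pushforward.
rewrite (_ : _ @^-1` _ = I ord0 `*` box (fun i => I (lift ord0 i))).
  rewrite product_measure1E//; last by apply: measurable_box => i; exact: mI.
  by rewrite IH// exprS EFinM; congr (_ * _)%E; exact: LI.
apply/seteqP; split=> -[x y] /=.
  move=> H; split; first by have := H ord0; rewrite tnth0.
  by move=> i; have := H (lift ord0 i); rewrite tnthS.
move=> [Ix Iy] i; have [->|[j ->]] : i = ord0 \/ exists j, i = lift ord0 j.
- by case: (unliftP ord0 i) => [j ->|->]; [right; exists j|left].
- by rewrite tnth0.
- by rewrite tnthS; exact: Iy.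
Qed.

Lemma cube_box n (c : Rn R n) (l : R) :
  cube c l = box (fun i => `[tnth c i, tnth c i + l]%classic).
Proof.
by apply/seteqP; split=> x /= cx i; have := cx i; rewrite /= in_itv.
Qed.

Lemma measurable_cube n (c : Rn R n) (l : R) : measurable (cube c l).
Proof. by rewrite cube_box; apply: measurable_box => i; exact: measurable_itv. Qed.

Lemma lebesgue_Rn_cube n (c : Rn R n) (l : R) : 0 < l ->
  lebesgue_Rn R n (cube c l) = (l ^+ n)%:E.
Proof.
move=> l0; rewrite cube_box; apply: lebesgue_Rn_box => i.
  exact: measurable_itv.
rewrite lebesgue_measure_itv /= lte_fin ltrDl l0 -EFinD; congr EFin; lra.
Qed.

Lemma vol_cube n (c : Rn R n) (l : R) : 0 < l -> vol (cube c l) = l ^+ n.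
Proof. by move=> l0; rewrite /vol lebesgue_Rn_cube. Qed.

End boxes.

Section dyadic.
Context {R : realType} {n : nat}.
Variables (c : Rn R n) (L : R).
Hypothesis L_gt0 : 0 < L.

Definition side K : R := L / 2 ^+ K.

Lemma side_gt0 K : 0 < side K.
Proof. by rewrite divr_gt0// exprn_gt0. Qed.

Lemma sideS K : side K = 2 * side K.+1.
Proof.
by rewrite /side exprS invfM; set X := (2 ^+ K)^-1; lra.
Qed.

(** The grid is anchored at [c] and covers the whole space: coordinates are
    arbitrary integers, and the base cell is the cell of [c] in generation 0. *)
Definition dyadic_coord K (x : Rn R n) i : int :=
  Num.floor ((tnth x i - tnth c i) / side K).

Definition dyadic_key K (x : Rn R n) : nat :=
  pickle [tuple dyadic_coord K x i | i < n].

Lemma dyadic_keyP K x y :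
  dyadic_key K x = dyadic_key K y <-> forall i, dyadic_coord K x i = dyadic_coord K y i.
Proof.
split=> [/(pcan_inj pickleK) xy i|xy].
  by have := congr1 (fun t => tnth t i) xy; rewrite !tnth_mktuple.
by congr pickle; apply: eq_from_tnth => i; rewrite !tnth_mktuple.
Qed.

Lemma dyadic_nested K x y :
  dyadic_key K.+1 x = dyadic_key K.+1 y -> dyadic_key K x = dyadic_key K y.
Proof.
move/dyadic_keyP => xy; apply/dyadic_keyP => i; have := xy i.
(* The integer m lies below y iff 2 m lies below 2 y, so the finer coordinate
   determines the integers below the coarser one. *)
have le_coord z m : (m <= dyadic_coord K z i) = (2 * m <= dyadic_coord K.+1 z i).
  rewrite !floor_ge_int !ler_pdivlMr ?side_gt0// sideS intrM.
  by congr (_ <= _); rewrite mulrCA mulrA.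
by move=> xyi; apply/le_anti; rewrite !le_coord -{1}xyi -le_coord lexx xyi
  -le_coord lexx.
Qed.

Lemma cell_dyadic K x : cell dyadic_key K x = box (fun i =>
  `[tnth c i + side K * (dyadic_coord K x i)%:~R,
    tnth c i + side K * (dyadic_coord K x i)%:~R + side K[%classic).
Proof.
apply/seteqP; split=> y.
  move=> /dyadic_keyP yx i; rewrite /= in_itv /=; rewrite -yx.
  have /andP[] := floor_itv ((tnth y i - tnth c i) / side K).
  rewrite -/(dyadic_coord K y i) ler_pdivlMr ?side_gt0// ltr_pdivrMr ?side_gt0//.
  rewrite intrD mulrDl mul1r mulrC => H1 H2; apply/andP; split; lra.
move=> yx; apply/dyadic_keyP => i; have := yx i; rewrite /= in_itv /=.
move=> /andP[H1 H2]; apply/floor_def.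
rewrite ler_pdivlMr ?side_gt0// ltr_pdivrMr ?side_gt0// intrD mulrDl mul1r.
by rewrite mulrC; apply/andP; split; lra.
Qed.

Lemma measurable_cell_dyadic K x : measurable (cell dyadic_key K x).
Proof.
by rewrite cell_dyadic; apply: measurable_box => i; exact: measurable_itv.
Qed.

Lemma lebesgue_Rn_cell K x :
  lebesgue_Rn R n (cell dyadic_key K x) = (side K ^+ n)%:E.
Proof.
rewrite cell_dyadic; apply: lebesgue_Rn_box => i; first exact: measurable_itv.
rewrite lebesgue_measure_itv /= lte_fin ltrDl side_gt0 -EFinD; congr EFin; lra.
Qed.

Lemma cell_sub_cube K x : exists c', cell dyadic_key K x `<=` cube c' (side K).
Proof.
exists [tuple tnth c i + side K * (dyadic_coord K x i)%:~R | i < n].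
rewrite cell_dyadic => y xy i; have := xy i.
by rewrite /= in_itv /= tnth_mktuple => /andP[-> /ltW].
Qed.

(** The cells are half-open and the cubes of atoms are closed, hence the strict
    inequality between the sides. *)
Lemma cube_sub_cell l : 0 < l -> l < L -> cube c l `<=` cell dyadic_key 0 c.
Proof.
move=> l0 lL x cx; apply/dyadic_keyP => i; have /andP[H1 H2] := cx i.
rewrite /dyadic_coord subrr mul0r floor0; apply: floor_def.
rewrite /side expr0 divr1 ler_pdivlMr// ltr_pdivrMr//.
by rewrite add0r mul0r mul1r; apply/andP; split; lra.
Qed.

(** If x_i < t, then the two points are separated by the grid as soon as the side
    is smaller than t - x_i. *)
Lemma half_space_dyadic i (t : R) : [set x : Rn R n | t <= tnth x i] =
  \bigcap_K [set x | Num.floor ((t - tnth c i) / side K) <= dyadic_coord K x i].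
Proof.
apply/seteqP; split=> [x /= tx K _ /=|x H /=].
  by apply: le_floor; rewrite ler_pM2r ?invr_gt0 ?side_gt0// lerB.
rewrite leNgt; apply/negP => xt.
have e0 : 0 < (t - tnth x i) / L by rewrite divr_gt0// subr_gt0.
have [K HK] : exists K : nat, 1 <= (t - tnth x i) / L * 2 ^+ K.
  exists (Num.bound ((t - tnth x i) / L)^-1).
  rewrite mulrC -ler_pdivrMr// mul1r.
  have := archi_boundP (ltW (_ : 0 < ((t - tnth x i) / L)^-1)).
  rewrite invr_gt0 => /(_ e0) /ltW /le_trans; apply.
  by rewrite -natrX ler_nat ltnW// ltn_expl.
have := H K I; rewrite /= leNgt => /negP; apply.
rewrite floor_lt_int.
apply: (@le_lt_trans _ _ ((t - tnth c i) / side K - 1)).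
  rewrite lerBrDr -lerBrDl -mulrBl; apply: le_trans HK _.
  by rewrite /side invf_div mulrA (mulrAC _ (2 ^+ K)) ler_pM2r ?exprn_gt0//
    ?ler_pM2r ?invr_gt0//; lra.
by rewrite ltrBlDr; have := floorD1_gt ((t - tnth c i) / side K); rewrite intrD.
Qed.

(** The product sigma-algebra is generated by the half-spaces, each of which is a
    countable intersection of unions of cells. *)
Lemma dyadic_generate (A : set (Rn R n)) : measurable A ->
  <<s saturated dyadic_key >> A.
Proof.
apply: smallest_sub; first exact: smallest_sigma_algebra.
rewrite -bigcup_seq => _ [i /= _ [B mB <-]]; rewrite setTI.
have [s0 sC sU] := smallest_sigma_algebra setT (saturated dyadic_key).
pose M := [set B : set R | <<s saturated dyadic_key >> ((fun x => tnth x i) @^-1` B)].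
suff : (@measurable _ (measurableTypeR R)) `<=` M by apply.
rewrite [X in X `<=` _](RGenCInfty.measurableE R); apply: smallest_sub.
  split=> [|U MU|F MF]; rewrite /M /=.
  - by rewrite preimage_set0.
  - by rewrite setTD preimage_setC -setTD; exact: sC.
  - by rewrite preimage_bigcup; exact: sU.
move=> _ [t ->]; rewrite /M /=.
rewrite (_ : _ @^-1` _ = [set x : Rn R n | t <= tnth x i]); last first.
  by apply/seteqP; split=> x; rewrite /= in_itv /= andbT.
rewrite half_space_dyadic -[X in <<s _ >> X]setCK setC_bigcap -setTD; apply: (sC).
apply: (sU) => K; rewrite -setTD; apply: (sC); apply: sub_sigma_algebra.
exists K, (dyadic_key K @`
  [set x | Num.floor ((t - tnth c i) / side K) <= dyadic_coord K x i]).
apply/seteqP; split=> [x Hx|x [y Hy /dyadic_keyP yx]]; first by exists x.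
by rewrite /= -yx.
Qed.

End dyadic.

(** * Decompositions into (1,oo)-atoms *)

Section H1_decompositions.
Context {R : realType} {n : nat}.
Local Notation mu := (lebesgue_Rn R n).
Local Notation T := (Rn R n).

Lemma decomposable_multiple (A : set (T -> R)) (f b : T -> R) (r : R) :
  A (fun=> 0) -> A b -> (forall x, f x = r * b x) -> decomposable A f `|r|.
Proof.
move=> A0 Ab fE.
exists (fun k => if k is 0 then r else 0), (fun k => if k is 0 then b else fun=> 0).
have le_r : (\sum_(0 <= j <oo) `|(if j is 0 then r else 0)%R|%:E <= `|r|%:E)%E.
  apply: nneseries_le => [k|[|N]]; rewrite ?lee_fin//.
    by rewrite big_ord0 lee_fin.
  by rewrite big_ord_recl big1 ?adde0// => k _; rewrite normr0.
split; last exact: le_r.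
apply/atomic_decompositionP; split; [by case|exact: le_lt_trans le_r (ltry _)|].
apply/cvge0P => [N|e e0]; first exact: L1_norm_ge0.
exists 1%N => -[//|N] _; rewrite (_ : (fun x => _) = fun=> 0).
  by rewrite L1_norm0 lee_fin ltW.
apply/funext => x; rewrite big_ord_recl big1 ?addr0 ?fE ?subrr// => k _.
by rewrite mul0r.
Qed.

Lemma decomposable_le (A : set (T -> R)) (f : T -> R) (w w' : R) :
  w <= w' -> decomposable A f w -> decomposable A f w'.
Proof.
move=> ww' [lam [a [H1 H2]]]; exists lam, a; split=> //.
by apply: le_trans H2 _; rewrite lee_fin.
Qed.

Lemma decomposable_scale (A : set (T -> R)) (f : T -> R) (r w : R) :
  (forall a, A a -> measurable_fun setT a) -> measurable_fun setT f ->
  decomposable A f w -> decomposable A (fun x => r * f x) (`|r| * w).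
Proof.
move=> mA mf [lam [a [/atomic_decompositionP[Aa lfin fa] lw]]].
exists (fun j => r * lam j), a.
have le_rw : (\sum_(0 <= j <oo) `|r * lam j|%:E <= (`|r| * w)%:E)%E.
  under eq_eseriesr do rewrite normrM EFinM.
  by rewrite nneseriesZl// EFinM; apply: lee_wpmul2l => //; rewrite lee_fin.
split=> //; apply/atomic_decompositionP.
split=> //; first exact: le_lt_trans le_rw (ltry _).
rewrite (_ : (fun _ => _) = (fun N => `|r|%:E *
    L1_norm mu (fun x => f x - \sum_(j < N) lam j * a j x)%R)%E).
  rewrite -(mule0 `|r|%:E); exact: cvgeZl.
apply/funext => N; rewrite -L1_normZ; last first.
  apply: measurable_funB => //; apply: measurable_sum => j.
  by apply: measurable_funM => //; exact: mA.
congr L1_norm; apply/funext => x; rewrite mulrBr mulr_sumr; congr (_ - _).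
by apply: eq_bigr => j _; rewrite mulrA.
Qed.

Lemma mu_setT_gt0 : (0 < mu setT)%E.
Proof.
have c : T := [tuple 0 | i < n].
apply: (@lt_le_trans _ _ (mu (cube c 1))).
  by rewrite lebesgue_Rn_cube// expr1n.
by apply: le_measure; rewrite ?inE//; exact: measurable_cube.
Qed.

Lemma Linfty_leP (f : T -> R) (M : R) :
  ('N[mu]_+oo[EFin \o f] <= M%:E)%E <-> {ae mu, forall x, `|f x| <= M}.
Proof.
rewrite unlock mu_setT_gt0; split=> [/ess_supP|H].
  by apply: filterS => x; rewrite /= lee_fin.
by apply/ess_supP; apply: filterS H => x; rewrite /= lee_fin.
Qed.

Lemma H1_atomP (Q : set T) (f : T -> R) c l : 0 < l -> Q = cube c l ->
  ((vol Q)%:E * 'N[mu]_+oo[EFin \o f] <= 1)%E <->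
  {ae mu, forall x, `|f x| <= (vol Q)^-1}.
Proof.
move=> l0 ->; rewrite vol_cube//; rewrite -Linfty_leP.
have v0 : 0 < l ^+ n by rewrite exprn_gt0.
by rewrite muleC -lee_pdivlMr// mul1e.
Qed.

Lemma H1_atoms0 : @H1_atoms R n (fun=> 0).
Proof.
pose c : T := [tuple 0 | i < n].
exists (cube c 1); split.
- by exists c, 1.
- exact: measurable_cst.
- by [].
- by rewrite /mean_zero integral0.
- apply/(@H1_atomP _ _ c 1) => //; apply: aeW => x.
  by rewrite normr0 vol_cube// invr_ge0 exprn_ge0.
Qed.

Lemma measurable_H1_atom (a : T -> R) : H1_atoms a -> measurable_fun setT a.
Proof. by case=> Q []. Qed.

Lemma L1_norm_H1_atom (a : T -> R) : H1_atoms a -> (L1_norm mu a <= 1)%E.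
Proof.
move=> [_ [[c [l [l0 ->]]] ma sa _ /(H1_atomP a l0 erefl)]]; rewrite vol_cube// => aM.
have v0 : 0 < l ^+ n by rewrite exprn_gt0.
have mQ := measurable_cube c l.
rewrite /L1_norm (@integral_supported _ _ _ _ (cube c l))//; last first.
  by move=> x /sa ->; rewrite normr0.
apply: (@le_trans _ _ (\int[mu]_(x in cube c l) ((l ^+ n)^-1)%:E)%E).
  apply: ae_ge0_le_integral => //.
  - apply/measurable_EFinP; apply: measurableT_comp => //.
    exact: measurable_funS ma.
  - by move=> x _; rewrite lee_fin invr_ge0 ltW.
  - by apply: filterS aM => x ? _; rewrite lee_fin.
rewrite integral_cst//.
suff : ((l ^- n)%:E * (l ^+ n)%:E <= 1)%E by rewrite -(lebesgue_Rn_cube c l0).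
by rewrite -EFinM mulVf// gt_eqF.
Qed.

(** A bounded function of integral 0 on a cube is a (1,oo)-atom times the bound
    times the volume. *)
Lemma decomposable_bounded (h : T -> R) (P : set T) c l M : 0 < l -> 0 < M ->
  P `<=` cube c l -> mu.-integrable setT (EFin \o h) ->
  (forall x, ~ P x -> h x = 0) -> (\int[mu]_(x in P) (h x)%:E = 0)%E ->
  {ae mu, forall x, `|h x| <= M} ->
  decomposable (@H1_atoms R n) h (M * l ^+ n).
Proof.
move=> l0 M0 Pc ih h0 mean hM.
have mh : measurable_fun setT h.
  by apply/measurable_EFinP; exact: measurable_int ih.
have r0 : 0 < M * l ^+ n by rewrite mulr_gt0// exprn_gt0.
rewrite -[X in decomposable _ _ X](gtr0_norm r0).
apply: (@decomposable_multiple _ _ (fun x => (M * l ^+ n)^-1 * h x)) => [||x];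
  first exact: H1_atoms0; last by rewrite mulrA divff ?mul1r ?gt_eqF.
have integral_h : (\int[mu]_(x in cube c l) (h x)%:E = 0)%E.
  by rewrite -mean; apply: integral_supported => // x /h0 ->.
exists (cube c l); split.
- by exists c, l.
- exact: measurable_funM.
- by move=> x ncx; rewrite h0 ?mulr0// => /Pc.
- rewrite /mean_zero; under eq_integral do rewrite EFinM.
  rewrite integralZl ?integral_h ?mule0//; first exact: measurable_cube.
  by apply: integrableS ih => //; exact: measurable_cube.
- apply/(H1_atomP _ l0 erefl); apply: filterS hM => x hx.
  rewrite vol_cube// normrM gtr0_norm ?invr_gt0// invfM mulrAC ler_piMl//.
    by rewrite invr_ge0 exprn_ge0// ltW.
  by rewrite mulrC ler_pdivrMr// mul1r.
Qed.

Section Calderon_Zygmund.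
Variables (c : T) (L : R) (a : T -> R) (q alpha : R).
Hypothesis L_gt0 : 0 < L.
Local Notation key := (dyadic_key c L).
Local Notation v := (fun K => side L K ^+ n).
Hypothesis a_integrable : mu.-integrable setT (EFin \o a).
Hypothesis a_supp : forall x, ~ cell key 0 c x -> a x = 0.
Hypothesis a_mean : \int[mu]_(x in cell key 0 c) a x = 0.
Hypothesis q_gt1 : 1 < q.
Hypothesis alpha_gt0 : 0 < alpha.
Hypothesis a_power :
  (\int[mu]_x (`|a x| `^ q)%:E <= (alpha `^ q * v 0)%:E)%E.

Let v_gt0 K : 0 < v K. Proof. by rewrite exprn_gt0// side_gt0. Qed.
Let v_ratio K : v K = 2 ^+ n * v K.+1.
Proof. by rewrite /= sideS exprMn. Qed.
Let D_ge1 : 1 <= 2 ^+ n :> R. Proof. by rewrite exprn_ege1// ler1n. Qed.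

Local Notation piece := (piece mu key v a alpha).
Local Notation delta := (delta mu key v a alpha).
Local Notation thr := (threshold alpha).
Local Notation ratio := (ratio q).

Let nest := @dyadic_nested R n c L L_gt0.
Let mcell := @measurable_cell_dyadic R n c L L_gt0.
Let mucell := @lebesgue_Rn_cell R n c L L_gt0.
Let gen := @dyadic_generate R n c L L_gt0.

Let delta_piece j m x := delta j x * \1_(piece j m) x.

Let mpiece j m : measurable (piece j m).
Proof. exact: measurable_piece. Qed.

Let pieceE j m : piece j m = set0 \/ exists K x, piece j m = cell key K x.
Proof.
have [->|[K [x [_ pE]]]] : piece j m = set0 \/
    exists K x, stops mu key v a alpha j K x /\ piece j m = cell key K x.
- exact: pieceP.
- by left.
- by right; exists K, x.
Qed.

Let idelta j : mu.-integrable setT (EFin \o delta j).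
Proof. by apply: integrable_delta => //; exact: v_gt0. Qed.

Let mdelta j : measurable_fun setT (delta j).
Proof. by apply/measurable_EFinP; exact: measurable_int (idelta j). Qed.

Let thr_gt0 j : 0 < thr j.+1.
Proof. by rewrite mulr_gt0// exprn_gt0. Qed.

(** The half-open cell [piece j m] is contained in a closed cube of the same
    volume, so the support condition of atoms costs nothing. *)
Lemma decomposable_delta_piece j m : decomposable (@H1_atoms R n)
  (delta_piece j m) (2 * 2 ^+ n * thr j.+1 * fine (mu (piece j m))).
Proof.
have [pE|[K [x pE]]] := pieceE j m.
  rewrite pE measure0 mulr0 -(normr0 R).
  apply: (@decomposable_multiple _ _ (fun=> 0)) => [||y]; try exact: H1_atoms0.
  by rewrite /delta_piece pE indic0 mulr0 mul0r.
have -> : fine (mu (piece j m)) = v K.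
  by rewrite pE; have /= -> := mucell K x.
have [c' sub_c'] := cell_sub_cube c L_gt0 K x.
apply: (@decomposable_bounded _ (piece j m) c').
- exact: side_gt0.
- by rewrite !mulr_gt0// exprn_gt0.
- by rewrite pE.
- apply: (le_integrable _ _ _ (idelta j)) => //.
    by apply/measurable_EFinP; apply: measurable_funM.
  move=> y _; rewrite /= lee_fin normrM ler_piMr//.
  by rewrite indicE normr_nat; case: (_ \in _).
- by move=> y npy; rewrite /delta_piece indicE memNset// mulr0.
- rewrite -(@integral_delta _ _ _ mu key nest mcell v v_gt0 mucell a alpha
    a_integrable alpha_gt0 j m).
  by apply: eq_integral => y py; rewrite /delta_piece indicE py mulr1.
- have := @ae_delta_le _ _ _ mu key nest mcell gen v (2 ^+ n) v_gt0 mucell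
    v_ratio D_ge1 c a alpha a_integrable a_supp a_mean alpha_gt0 j.
  apply: filterS => y; apply: le_trans.
  rewrite normrM ler_piMr//.
  by rewrite indicE normr_nat; case: (_ \in _).
Qed.

Lemma decomposable_delta j : decomposable (@H1_atoms R n) (delta j)
  (4 * 2 ^+ n * (alpha * v 0 * ratio ^+ j)).
Proof.
apply: (decomposable_series H1_atoms0 measurable_H1_atom L1_norm_H1_atom
  (mdelta j) _ (decomposable_delta_piece j)).
- by move=> m; apply: measurable_funM.
- move=> N; rewrite -mulr_sumr.
  have := @sum_threshold_mu _ _ _ mu key nest mcell v mucell c a q alpha
    a_integrable a_supp q_gt1 alpha_gt0 a_power j.
  have sumE : (\sum_(m < N) mu (piece j m) =
      (\sum_(m < N) fine (mu (piece j m)))%:E)%E.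
    rewrite -sumEFin; apply: eq_bigr => m _; rewrite fineK//.
    have [->|[K [x ->]]] := pieceE j m.
      by rewrite measure0.
    by have /= -> := mucell K x.
  move=> H; rewrite (_ : 4 = 2 * 2 :> R); last lra.
  rewrite -!mulrA ler_pM2l// [leRHS]mulrCA ler_pM2l ?exprn_gt0//.
  rewrite (mulrA alpha) (mulrA alpha (side L 0 ^+ n)) -lee_fin.
  apply: le_trans H; rewrite EFinM lee_pmul2l ?lte_fin ?thr_gt0//.
  by rewrite -sumE; exact: nneseries_ge_partial.
- have tP := @trivIset_piece _ _ _ mu key v a alpha j.
  apply: (cvg_partition (mpiece j) tP (idelta j)) => x.
  exact: (delta_out v_gt0 alpha_gt0).
Qed.

Lemma decomposable_Calderon_Zygmund : decomposable (@H1_atoms R n) a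
  (4 * 2 ^+ n * (alpha * v 0) / (1 - ratio)).
Proof.
have /andP[r0 r1] := ratio_lt1 q_gt1.
apply: (decomposable_series H1_atoms0 measurable_H1_atom L1_norm_H1_atom
  _ mdelta decomposable_delta).
- by apply/measurable_EFinP; exact: measurable_int a_integrable.
- move=> N; rewrite -mulr_sumr -!mulrA ler_pM2l// ler_pM2l ?exprn_gt0//.
  rewrite -mulr_sumr mulrA ler_pM2l ?mulr_gt0//.
  rewrite -[leRHS]mul1r ler_pdivlMr ?subr_gt0//.
  have -> : (\sum_(j < N) ratio ^+ j) * (1 - ratio) = 1 - ratio ^+ N.
    elim: N => [|N IH]; first by rewrite big_ord0 mul0r expr0 subrr.
    by rewrite big_ord_recr /= mulrDl IH exprS; lra.
  by rewrite lerBlDr lerDl exprn_ge0// ltW.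
- exact: (@cvg_sum_delta _ _ _ mu key nest mcell gen v (2 ^+ n) v_gt0 mucell
    v_ratio D_ge1 c a q alpha a_integrable a_supp a_mean q_gt1 alpha_gt0 a_power).
Qed.

End Calderon_Zygmund.

End H1_decompositions.

(** * Comparison of the two families of atoms *)

(** 2^(q-1) = exp u with u = (q-1) ln 2, and exp u >= 1 + u; so the sum of the
    geometric series blows up no faster than the conjugate exponent q/(q-1). *)
Lemma inv_sub_ratio_le (R : realType) (q : R) : 1 < q ->
  (1 - ratio q)^-1 <= (1 + (ln 2)^-1) * (q / (q - 1)).
Proof.
move=> q1; have qm : 0 < q - 1 by rewrite subr_gt0.
have l2 : 0 < ln 2 :> R by rewrite ln_gt0// ltr1n.
pose u := (q - 1) * ln 2; have u0 : 0 < u by rewrite mulr_gt0.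
have u1 : 0 < 1 + u by rewrite addr_gt0.
have /andP[r0 r1] := ratio_lt1 q1.
have ratioE : ratio q = (expR u)^-1.
  by rewrite /ratio /powR gt_eqF// -expRN /u -mulNr opprB.
have ru : ratio q <= (1 + u)^-1.
  by rewrite ratioE lef_pV2 ?posrE ?expR_gt0// expR_ge1Dx.
have le1 : (1 - ratio q)^-1 <= 1 + u^-1.
  have -> : 1 + u^-1 = (1 - (1 + u)^-1)^-1.
    have -> : 1 - (1 + u)^-1 = u / (1 + u).
      by rewrite -{1}(@divff _ (1 + u)) ?gt_eqF// -{2}(mul1r (1 + u)^-1)
        -mulrBl addrAC subrr add0r.
    by rewrite invf_div mulrDl mul1r divff ?gt_eqF// addrC.
  rewrite lef_pV2 ?posrE ?subr_gt0//; first by rewrite lerD2l lerN2.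
  by rewrite invf_lt1// ltrDl.
apply: le_trans le1 _; rewrite mulrDl mul1r; apply: lerD.
  by rewrite ler_pdivlMr// mul1r gerBl.
rewrite /u invfM mulrC ler_pM2l ?invr_gt0//.
by rewrite ler_peMl ?invr_ge0 ?ltW.
Qed.

Section atoms.
Context {R : realType} {n : nat}.
Local Notation mu := (lebesgue_Rn R n).
Local Notation T := (Rn R n).

Lemma measurable_atoms_s (s : \bar R) (a : T -> R) :
  atoms_s s a -> measurable_fun setT a.
Proof. by move=> [q [Q [_ _ _ [p []]]]]. Qed.

Definition H1_constant : R := 4 * 2 ^+ n * 2 ^+ n * (1 + (ln 2)^-1).

(** Solves the size condition of (q,s)-atoms for the integral of |a|^q, and shows
    on the way that it is finite. *)
Lemma power_integral_le (J : \bar R) (w C q : R) : 0 < w -> 0 < C -> 0 < q ->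
  (0 <= J)%E -> (C%:E * (w^-1%:E * J) `^ q^-1 <= 1)%E ->
  (J <= (C^-1 `^ q * w)%:E)%E.
Proof.
move=> w0 C0 q0 J0; case: J J0 => [J| |//].
- rewrite lee_fin => J0.
  have wJ : 0 <= w^-1 * J by rewrite mulr_ge0// invr_ge0 ltW.
  rewrite -!EFinM lee_fin => H.
  rewrite lee_fin mulrC -ler_pdivrMl//.
  rewrite -[leLHS]powRr1// -(mulVf (lt0r_neq0 q0)) powRrM.
  apply: ge0_ler_powR; rewrite ?nnegrE ?powR_ge0 ?invr_ge0 ?(ltW q0) ?(ltW C0)//.
  by rewrite -[leRHS]mul1r ler_pdivlMr// mulrC.
- move=> _; rewrite gt0_muley ?lte_fin ?invr_gt0//.
  by rewrite poweRyr ?invr_eq0 ?gt_eqF// gt0_muley ?lte_fin.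
Qed.

(** The stopping-time decomposition is applied to a grid of side 2l, where l is the
    side of the defining cube.  The factors of [H1_constant] are 4 times 2^n from
    the weights, 2^n for the volume of the base cell relative to the defining
    cube, and the constant of [inv_sub_ratio_le]. *)
Lemma decomposable_atoms_s (s : R) (a : T -> R) : 0 < s -> s < 1 ->
  atoms_s s%:E a -> decomposable (@H1_atoms R n) a H1_constant.
Proof.
move=> s0 s1 [q [_ [q1 _ [c [l [l0 ->]]] [p [pq ma supp_a mean_a size_a]]]]].
have q0 : 0 < q by apply: lt_trans q1.
have qm : 0 < q - 1 by rewrite subr_gt0.
have pE : p = q / (q - 1).
  apply: invr_inj; rewrite invf_div -(addrK q^-1 p^-1) pq mulrBl divff ?gt_eqF//.
  by rewrite mul1r.
have p1 : 1 <= p by rewrite pE ler_pdivlMr// mul1r gerBl.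
have p0 : 0 < p by apply: lt_le_trans p1.
have sV : fine (s%:E^-1)%E = s^-1 by rewrite inver gt_eqF.
have w0 : 0 < l ^+ n by rewrite exprn_gt0.
have ps : 1 <= s^-1 by rewrite invf_ge1// ltW.
move: size_a; rewrite sV vol_cube//.
have psw0 : 0 < p `^ s^-1 * l ^+ n by rewrite mulr_gt0// powR_gt0.
set J := (\int[mu]_(x in _) _)%E => size_a.
have J0 : (0 <= J)%E by apply: integral_ge0 => x _; rewrite lee_fin powR_ge0.
have := power_integral_le w0 psw0 q0 J0 size_a.
set alpha := (p `^ s^-1 * l ^+ n)^-1 => Jle.
have alpha0 : 0 < alpha by rewrite invr_gt0.
have L0 : 0 < 2 * l by rewrite mulr_gt0.
have lL : l < 2 * l by rewrite ltr_pMl// ltr1n.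
have sub := @cube_sub_cell R n c (2 * l) L0 l l0 lL.
have mQ := measurable_cube c l.
have side0 : side (2 * l) 0 ^+ n = 2 ^+ n * l ^+ n.
  by rewrite /side expr0 divr1 exprMn.
have power : (\int[mu]_x (`|a x| `^ q)%:E = J)%E.
  apply: integral_supported => // x /supp_a ->.
  by rewrite normr0 powR0// gt_eqF.
have mpow : measurable_fun setT (fun x => `|a x| `^ q).
  exact: measurable_norm_powR.
(* Integrability follows from |a| <= 1 + |a|^q on the cube. *)
have ia : mu.-integrable setT (EFin \o a).
  apply: (@le_integrable _ _ _ _ _ _ _
      (fun x => (\1_(cube c l) x + `|a x| `^ q)%:E)) => //.
  - exact/measurable_EFinP.
  - move=> x _; rewrite lee_fin.
    have [Qx|/supp_a ->] := pselect (cube c l x); last first.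
      by rewrite normr0.
    rewrite [leRHS]ger0_norm ?addr_ge0 ?powR_ge0// indicE mem_set//.
    have [a1|a1] := leP `|a x| 1; first by rewrite ler_wpDr ?powR_ge0.
    apply: ler_wpDl => //; apply: le1r_powR; exact: ltW.
  - rewrite (_ : (fun x => _) = (fun x => (\1_(cube c l) x : R)%:E) \+
      (fun x => (`|a x| `^ q)%:E))%E; last by apply/funext.
    apply: integrableD => //.
      apply: integrable_indic_lty => //.
      suff : ((l ^+ n)%:E < +oo)%E by rewrite -(lebesgue_Rn_cube c l0).
      exact: ltry.
    apply/integrableP; split; first exact/measurable_EFinP.
    under eq_integral do rewrite gee0_abs ?lee_fin ?powR_ge0//.
    by rewrite power (le_lt_trans Jle)// ltry.
have := @decomposable_Calderon_Zygmund R n c (2 * l) a q alpha L0 ia.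
have out x : ~ cell (dyadic_key c (2 * l)) 0 c x -> a x = 0.
  by move=> nx; apply: supp_a => /sub.
have mean : \int[mu]_(x in cell (dyadic_key c (2 * l)) 0 c) a x = 0.
  rewrite /Rintegral (integral_supported mu sub) ?mean_a// => x /supp_a.
  by move=> /= ->.
move=> /(_ out mean q1 alpha0).
rewrite power side0 => H; apply: decomposable_le (H _); last first.
  apply: le_trans Jle _; rewrite lee_fin ler_wpM2l ?powR_ge0//.
  by rewrite ler_peMl ?(ltW w0)// exprn_ege1// ler1n.
have ap : alpha * (2 ^+ n * l ^+ n) = 2 ^+ n * (p `^ s^-1)^-1.
  rewrite /alpha invfM.
  transitivity (2 ^+ n * (p `^ s^-1)^-1 * ((l ^+ n)^-1 * l ^+ n)); first lra.
  by rewrite mulVf ?mulr1// gt_eqF.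
rewrite ap /H1_constant -!mulrA ler_pM2l// !ler_pM2l ?exprn_gt0//.
apply: (@le_trans _ _ ((p `^ s^-1)^-1 * ((1 + (ln 2)^-1) * p))).
  rewrite ler_pM2l ?invr_gt0 ?powR_gt0// pE.
  exact: inv_sub_ratio_le.
(* Here s < 1 enters: p <= p^(1/s) because p >= 1 and 1/s >= 1. *)
rewrite mulrCA ler_piMr//.
  by rewrite addr_ge0// invr_ge0 ln_ge0// ler1n.
by rewrite mulrC ler_pdivrMr ?powR_gt0// mul1r le1r_powR.
Qed.

(** The exponent q = 2 is its own conjugate, so the factor p^(1/s) is 2^(1/s). *)
Lemma H1_atom_atoms_s (s : R) (a : T -> R) : 0 < s -> H1_atoms a ->
  atoms_s s%:E (fun x => (2 `^ s^-1)^-1 * a x).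
Proof.
move=> s0 Ha; have a_norm := L1_norm_H1_atom Ha.
move: Ha => [_ [[c [l [l0 ->]]] ma supp_a mean_a /(H1_atomP a l0 erefl)]].
rewrite vol_cube// => aM.
have w0 : 0 < l ^+ n by rewrite exprn_gt0.
have k0 : 0 < 2 `^ s^-1 :> R by rewrite powR_gt0.
have mQ := measurable_cube c l.
have sV : fine (s%:E^-1)%E = s^-1 by rewrite inver gt_eqF.
exists 2, (cube c l); split => //; [by rewrite ltr1n|by exists c, l|].
exists 2; split.
- lra.
- exact: measurable_funM.
- by move=> x /supp_a ->; rewrite mulr0.
- rewrite /mean_zero; under eq_integral do rewrite EFinM.
  rewrite integralZl//; first by rewrite (mean_a : integral _ _ _ = _) mule0.
  apply: (@integrableS _ _ _ _ setT) => //.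
  apply/integrableP; split; first exact/measurable_EFinP.
  by apply: le_lt_trans (ltry 1).
rewrite sV vol_cube//.
set J := (\int[mu]_(x in _) _)%E.
have M0 : 0 <= (2 `^ s^-1 * l ^+ n)^-1 by rewrite invr_ge0 mulr_ge0 ?ltW.
have Jle : (J <= ((2 `^ s^-1 * l ^+ n)^-1 ^+ 2 * l ^+ n)%:E)%E.
  apply: (@le_trans _ _
    (\int[mu]_(x in cube c l) ((2 `^ s^-1 * l ^+ n)^-1 ^+ 2)%:E)%E).
    apply: ae_ge0_le_integral => //.
    - apply/measurable_EFinP.
      apply: measurable_norm_powR; apply: measurable_funM => //.
      exact: measurable_funS ma.
    - by move=> x _; rewrite lee_fin exprn_ge0.
    - apply: filterS aM => x ax _; rewrite lee_fin powR_mulrn//.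
      rewrite lerXn2r ?nnegrE// normrM gtr0_norm ?invr_gt0// invfM.
      by rewrite ler_pM2l ?invr_gt0.
  by rewrite integral_cst// [leRHS]EFinM -(lebesgue_Rn_cube c l0).
have J0 : (0 <= J)%E by apply: integral_ge0 => x _; rewrite lee_fin powR_ge0.
apply: (@le_trans _ _ ((2 `^ s^-1 * l ^+ n)%:E *
    ((2 `^ s^-1 * l ^+ n)^-1 ^+ 2)%:E `^ 2^-1)%E).
  apply: lee_wpmul2l; first by rewrite lee_fin mulr_ge0 ?ltW.
  apply: gt0_ler_poweR => //.
  - by rewrite in_itv /= leey andbT mule_ge0// lee_fin invr_ge0 ltW.
  - by rewrite in_itv /= leey andbT lee_fin exprn_ge0.
  apply: (@le_trans _ _ ((l ^- n)%:E *
      ((2 `^ s^-1 * l ^+ n)^-1 ^+ 2 * l ^+ n)%:E)%E).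
    by apply: lee_wpmul2l => //; rewrite lee_fin invr_ge0 ltW.
  by rewrite -EFinM lee_fin mulrC mulfK ?gt_eqF.
rewrite poweR_EFin -(powR_mulrn 2 M0) -powRrM divff// powRr1//.
by rewrite -EFinM divff// gt_eqF// mulr_gt0.
Qed.

Lemma fin_total_weight (A : set (T -> R)) (f : T -> R) (lam : nat -> R)
    (a : nat -> T -> R) : atomic_decomposition A f lam a ->
  exists w : R, (\sum_(0 <= j <oo) `|lam j|%:E = w%:E)%E.
Proof.
move=> [_ lfin _]; exists (fine (\sum_(0 <= j <oo) `|lam j|%:E)%E).
rewrite fineK// ge0_fin_numE//.
by apply: nneseries_ge0 => j _ _; rewrite lee_fin.
Qed.

Lemma atomic_norm_le (A B : set (T -> R)) (C : R) (f : T -> R) : 0 < C ->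
  (forall lam a w, atomic_decomposition A f lam a ->
    (\sum_(0 <= j <oo) `|lam j|%:E <= w%:E)%E -> decomposable B f (C * w)) ->
  (atomic_norm B f <= C%:E * atomic_norm A f)%E.
Proof.
move=> C0 AB; rewrite muleC -lee_pdivrMr//.
apply: le_ereal_inf_tmp => _ [lam [a [fa ->]]].
rewrite lee_pdivrMr// muleC.
have [w wE] := fin_total_weight fa; rewrite wE.
have [|lam' [b [fb lb]]] := AB lam a w fa; first by rewrite wE.
by rewrite -EFinM; apply: le_trans lb; apply: ereal_inf_lbound; exists lam', b.
Qed.

Lemma decomposable_H1_of_X (s : R) (f : T -> R) (lam : nat -> R)
    (a : nat -> T -> R) (w : R) : 0 < s -> s < 1 ->
  measurable_fun setT f -> atomic_decomposition (atoms_s s%:E) f lam a ->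
  (\sum_(0 <= j <oo) `|lam j|%:E <= w%:E)%E ->
  decomposable (@H1_atoms R n) f (H1_constant * w).
Proof.
move=> s0 s1 mf /atomic_decompositionP[Aa _ fa] lw.
have ma j : measurable_fun setT (a j) := measurable_atoms_s (Aa j).
have mla j : measurable_fun setT (fun x => lam j * a j x).
  exact: measurable_funM.
have dj j := decomposable_scale (lam j) measurable_H1_atom (ma j)
  (decomposable_atoms_s s0 s1 (Aa j)).
apply: (decomposable_series H1_atoms0 measurable_H1_atom L1_norm_H1_atom
  mf mla dj _ fa) => N.
rewrite -mulr_suml mulrC ler_pM2l; last first.
  by rewrite /H1_constant !mulr_gt0 ?exprn_gt0// addr_gt0// invr_gt0 ln_gt0// ltr1n.
rewrite -lee_fin; apply: le_trans lw; rewrite -sumEFin.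
by apply: (nneseries_ge_partial (u := fun j => `|lam j|%:E)) => j; rewrite lee_fin.
Qed.

Lemma decomposable_X_of_H1 (s : R) (f : T -> R) (lam : nat -> R)
    (a : nat -> T -> R) (w : R) : 0 < s ->
  atomic_decomposition (@H1_atoms R n) f lam a ->
  (\sum_(0 <= j <oo) `|lam j|%:E <= w%:E)%E ->
  decomposable (atoms_s s%:E) f (2 `^ s^-1 * w).
Proof.
move=> s0 /atomic_decompositionP[Aa _ fa] lw.
pose k : R := 2 `^ s^-1; have k0 : 0 < k by rewrite powR_gt0.
exists (fun j => k * lam j), (fun j x => k^-1 * a j x).
have le_kw : (\sum_(0 <= j <oo) `|k * lam j|%:E <= (k * w)%:E)%E.
  under eq_eseriesr do rewrite normrM EFinM (gtr0_norm k0).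
  by rewrite nneseriesZl// EFinM; apply: lee_wpmul2l => //; rewrite lee_fin ltW.
split=> //; apply/atomic_decompositionP; split.
- by move=> j; exact: H1_atom_atoms_s.
- exact: le_lt_trans le_kw (ltry _).
- rewrite (_ : (fun _ => _) = (fun N =>
    L1_norm mu (fun x => f x - \sum_(j < N) lam j * a j x)%R))//.
  apply/funext => N; congr L1_norm; apply/funext => x; congr (_ - _).
  by apply: eq_bigr => j _; rewrite mulrACA divff ?mul1r// gt_eqF.
Qed.

End atoms.

Theorem proposition2p1 (R : realType) (n : nat) (s : R)
    (n_gt0 : (0 < n)%N) (s_gt0 : 0 < s) (s_lt1 : s < 1) :
  X_space R n s%:E = H1_space R n /\
  exists C1 C2 : R, [/\ 0 < C1, 0 < C2 &
    forall f, H1_space R n f ->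
      (X_norm s%:E f <= C1%:E * H1_norm f)%E /\
      (H1_norm f <= C2%:E * X_norm s%:E f)%E].
Proof.
have H1_of_X f lam a w (mf : measurable_fun setT f) :=
  @decomposable_H1_of_X R n s f lam a w s_gt0 s_lt1 mf.
have X_of_H1 f lam a w := @decomposable_X_of_H1 R n s f lam a w s_gt0.
have mf (f : Rn R n -> R) : (lebesgue_Rn R n).-integrable setT (EFin \o f) ->
    measurable_fun setT f.
  by move=> intf; apply/measurable_EFinP; exact: measurable_int intf.
split.
  apply/seteqP; split=> f [intf [lam [a fa]]]; split=> //.
    have [w wE] := fin_total_weight fa.
    have [|lam' [b [fb _]]] := H1_of_X f lam a w (mf _ intf) fa.
      by rewrite wE.
    by exists lam', b.
  have [w wE] := fin_total_weight fa.
  have [|lam' [b [fb _]]] := X_of_H1 f lam a w fa; first by rewrite wE.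
  by exists lam', b.
exists (2 `^ s^-1), (@H1_constant R n); split.
- by rewrite powR_gt0.
- by rewrite /H1_constant !mulr_gt0 ?exprn_gt0// addr_gt0// invr_gt0 ln_gt0// ltr1n.
move=> f [/mf measurable_f _]; split; apply: atomic_norm_le.
- by rewrite powR_gt0.
- exact: X_of_H1.
- by rewrite /H1_constant !mulr_gt0 ?exprn_gt0// addr_gt0// invr_gt0 ln_gt0// ltr1n.
- by move=> lam a w; exact: H1_of_X.
Qed.
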